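(* Let $\mathcal{P}=\mathcal{P}'\uplus\{\ell\to\{p_1:r_1,\dots,p_k:r_k\}^m\}$ be an ADP problem and let $N=\{\ell\delta\to\{p_1:r_1\delta,\dots,p_k:r_k\delta\}^m\mid \ell'\to\{p'_1:r'_1,\dots,p'_h:r'_h\}^{m'}\in\mathrm{vr}(\mathcal{P}),\ 1\le j\le h,\ t\trianglelefteq_\# r'_j,\ \delta=\mathrm{mgu}(\mathrm{Cap}_{\mathcal{P}}(t^\#),\ell^\#),\ \{\ell'\delta,\ell\delta\}\subseteq\mathtt{ANF}_{\mathcal{P}}\}$. Then $\mathcal{P}$ is iAST if and only if $\mathcal{P}'\cup N\cup\{\ell\to\{p_1:\flat(r_1),\dots,p_k:\flat(r_k)\}^m\}$ is iAST (i.e., the instantiation processor is sound and complete).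
   Context: Fix a finite signature $\Sigma=\mathcal{D}\uplus\mathcal{C}$ (defined symbols and constructors) and a set of variables $\mathcal{V}$; all left-hand sides of ADPs have root in $\mathcal{D}$. For each $f\in\mathcal{D}$ let $f^\#$ be a fresh symbol of the same arity, $\mathcal{D}^\#=\{f^\#\mid f\in\mathcal{D}\}$, $\Sigma^\#=\Sigma\uplus\mathcal{D}^\#$; elements of $\mathcal{T}(\Sigma^\#,\mathcal{V})$ are annotated terms. $\mathrm{pos}_{\Sigma'}(t)$ is the set of positions of $t$ carrying a symbol of $\Sigma'$. $\flat(t)$ removes all annotations from $t$; $t^\#$ is $t$ with its (defined) root symbol annotated and no other annotations; $\flat_{\uparrow\pi}(t)$ removes all annotations strictly above position $\pi$. $t\trianglelefteq_\# s$ means $t=\flat(s|_\pi)$ for some $\pi\in\mathrm{pos}_{\mathcal{D}^\#}(s)$. A finite multi-distribution on $A\neq\emptyset$ is a finite multiset of pairs $(p:a)$, $0<p\le1$, $a\in A$, with probabilities summing to 1. An ADP is $\ell\to\{p_1:r_1,\dots,p_k:r_k\}^m$ with $\ell\in\mathcal{T}(\Sigma,\mathcal{V})\setminus\mathcal{V}$, $m\in\{\mathsf{true},\mathsf{false}\}$, $\{p_1:r_1,\dots,p_k:r_k\}$ a finite multi-distribution on $\mathcal{T}(\Sigma^\#,\mathcal{V})$, $\mathcal{V}(r_j)\subseteq\mathcal{V}(\ell)$. An ADP problem is a finite set $\mathcal{P}$ of ADPs. An annotated term $t$ is a $\mathcal{P}$-normal form if no subterm of $\flat(t)$ is an instance of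 a left-hand side of $\mathcal{P}$; $\mathtt{ANF}_{\mathcal{P}}$ is the set of annotated terms whose proper subterms are all $\mathcal{P}$-normal forms. $s\hookrightarrow_{\mathcal{P}}\{p_1:t_1,\dots,p_k:t_k\}$ holds if there are an ADP $\ell\to\{p_1:r_1,\dots,p_k:r_k\}^m\in\mathcal{P}$, a substitution $\sigma$ and $\pi\in\mathrm{pos}_{\mathcal{D}\cup\mathcal{D}^\#}(s)$ with $\flat(s|_\pi)=\ell\sigma\in\mathtt{ANF}_{\mathcal{P}}$ such that for all $j$: (pr) $t_j=s[r_j\sigma]_\pi$ if $\pi\in\mathrm{pos}_{\mathcal{D}^\#}(s)$, $m=\mathsf{true}$; (p) $t_j=\flat_{\uparrow\pi}(s[r_j\sigma]_\pi)$ if $\pi\in\mathrm{pos}_{\mathcal{D}^\#}(s)$, $m=\mathsf{false}$; (r) $t_j=s[\flat(r_j)\sigma]_\pi$ if $\pi\notin\mathrm{pos}_{\mathcal{D}^\#}(s)$, $m=\mathsf{true}$; (irr) $t_j=\flat_{\uparrow\pi}(s[\flat(r_j)\sigma]_\pi)$ if $\pi\notin\mathrm{pos}_{\mathcal{D}^\#}(s)$, $m=\mathsf{false}$. A $\mathcal{P}$-chain tree (CT) is $\mathfrak{T}=(V,E,L,V_P)$: (1) $(V,E)$ a (possibly infinite) directed tree, $V\neq\emptyset$, every node with finitely many children; (2) $L$ labels each node $v$ with $(p_v,t_v)\in(0,1]\times\mathcal{T}(\Sigma^\#,\mathcal{V})$, $p_v=1$ at the root; (3) $V_P$ is a set of inner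 nodes, $V_R$ the remaining inner nodes; (4) if $v\in V_P$ has children $w_1,\dots,w_k$ then $t_v\hookrightarrow_{\mathcal{P}}\{\frac{p_{w_1}}{p_v}:t_{w_1},\dots,\frac{p_{w_k}}{p_v}:t_{w_k}\}$ by case (pr) or (p); (5) likewise for $v\in V_R$ by case (r) or (irr); (6) every infinite path contains infinitely many nodes of $V_P$. $|\mathfrak{T}|_{\mathtt{Leaf}}$ is the sum of $p_v$ over all leaves. $\mathcal{P}$ is iAST if $|\mathfrak{T}|_{\mathtt{Leaf}}=1$ for every $\mathcal{P}$-CT. $\mathrm{vr}(\mathcal{P})$ is a variable-renamed copy of $\mathcal{P}$ in which all variables are replaced by fresh ones. $\mathrm{Cap}_{\mathcal{P}}(t)$ results from $t$ by replacing all subterms whose root is a defined symbol of $\mathcal{P}$ (the root of a left-hand side of an ADP in $\mathcal{P}$) by pairwise different fresh variables (different occurrences of the same subterm get different variables). $\mathrm{mgu}$ denotes a most general unifier; if none exists, no element is contributed to $N$. *)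

(* Defs.v *)
From mathcomp Require Import all_boot all_order all_algebra.
From mathcomp Require Import all_classical all_reals all_analysis.

Set Implicit Arguments.
Unset Strict Implicit.
Unset Printing Implicit Defensive.

Import Order.TTheory GRing.Theory Num.Theory.
Local Open Scope classical_set_scope.
Local Open Scope ring_scope.

(* The constructors are the symbols that are not [defined]. *)
Record signature := Signature {
  sym : finType;
  arity : sym -> nat;
  defined : pred sym }.

Section Terms.
Variables (S : signature) (V : Type).

(* The annotated signature: [inl f] is the plain symbol f and [inr f] is its
   annotated version, which exists only for defined f. *)
Definition asym : Type := (sym S + {f : sym S | defined f})%type.

Definition flat_sym (g : asym) : sym S :=
  match g with inl f => f | inr f => val f end.

Definition aarity (g : asym) : nat := arity (flat_sym g).

(* Annotated terms; the unannotated terms are those satisfying [unannotated]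
   below. *)
Inductive term : Type :=
| Var of V
| App (g : asym) of ('I_(aarity g) -> term).

Definition root_sym (t : term) : option asym :=
  match t with Var _ => None | App g _ => Some g end.

Definition is_defined_root (t : term) : Prop :=
  exists2 g, root_sym t = Some g & defined (flat_sym g).

Definition is_annotated_root (t : term) : Prop :=
  exists f, root_sym t = Some (inr f).

Fixpoint vars (t : term) : set V :=
  match t with
  | Var x => [set x]
  | App _ args => [set x | exists i, vars (args i) x]
  end.

Fixpoint flat (t : term) : term :=
  match t with
  | Var x => Var x
  | App g args => @App (inl (flat_sym g)) (fun i => flat (args i))
  end.

Definition annotate_root (t : term) : term :=
  match t with
  | App (inl f) args =>
      match pselect (defined f) with
      | left df => @App (inr (exist _ f df)) args
      | right _ => t
      end
  | _ => t
  end.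

Definition sharp (t : term) : term := annotate_root (flat t).

Definition position := seq nat.

(* [None] when the position does not exist in the term; arguments are numbered
   from 0. *)
Fixpoint subterm_at (t : term) (pi : position) : option term :=
  match pi with
  | [::] => Some t
  | i :: pi' =>
      match t with
      | Var _ => None
      | App g args =>
          match insub i : option 'I_(aarity g) with
          | Some j => subterm_at (args j) pi'
          | None => None
          end
      end
  end.

Fixpoint replace_at (t : term) (pi : position) (u : term) : term :=
  match pi with
  | [::] => u
  | i :: pi' =>
      match t with
      | Var x => Var x
      | App g args =>
          @App g (fun j => if val j == i then replace_at (args j) pi' u
                           else args j)
      end
  end.

Fixpoint flat_above (pi : position) (t : term) : term :=
  match pi with
  | [::] => t
  | i :: pi' =>
      match t with
      | Var x => Var x
      | App g args =>
          @App (inl (flat_sym g))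
            (fun j => if val j == i then flat_above pi' (args j) else args j)
      end
  end.

Definition defined_pos (t : term) : set position :=
  [set pi | exists2 u, subterm_at t pi = Some u & is_defined_root u].

Definition annotated_pos (t : term) : set position :=
  [set pi | exists2 u, subterm_at t pi = Some u & is_annotated_root u].

Definition unannotated (t : term) : Prop := annotated_pos t = set0.

Definition annotated_subterm (t s : term) : Prop :=
  exists pi u,
    [/\ annotated_pos s pi, subterm_at s pi = Some u & t = flat u].

Definition substitution := V -> term.

Fixpoint subst (sigma : substitution) (t : term) : term :=
  match t with
  | Var x => sigma x
  | App g args => @App g (fun i => subst sigma (args i))
  end.

Definition is_unifier (s t : term) (delta : substitution) : Prop :=
  subst delta s = subst delta t.

(* "More general" is required on all variables, not only on those of s and t. *)
Definition is_mgu (s t : term) (delta : substitution) : Prop :=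
  is_unifier s t delta /\
  forall theta, is_unifier s t theta ->
    exists kappa, forall x, theta x = subst kappa (delta x).

(* [mgu] picks one most general unifier whenever there is one. *)
Definition mgu_choice (mgu : term -> term -> option substitution) : Prop :=
  forall s t,
    match mgu s t with
    | Some delta => is_mgu s t delta
    | None => ~ exists delta, is_mgu s t delta
    end.

End Terms.

Arguments App {S V}.

Section ADP.
Variables (R : realType) (S : signature) (V : Type).
Local Notation term := (term S V).
Local Notation substitution := (substitution S V).

(* A multi-distribution is given by a list of its elements, with
   multiplicities; chain trees do not depend on the order of the list. *)
Definition is_multidistr (mu : seq (R * term)) : Prop :=
  (forall j p r, onth mu j = Some (p, r) -> 0 < p <= 1) /\
  \sum_(pr <- mu) pr.1 = 1.

Record adp := Adp {
  lhs : term;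
  rhs : seq (R * term);
  flag : bool }.

Definition wf_adp (a : adp) : Prop :=
  [/\ unannotated (lhs a),
      is_defined_root (lhs a),
      is_multidistr (rhs a) &
      forall j p r, onth (rhs a) j = Some (p, r) -> vars r `<=` vars (lhs a)].

Definition adp_problem (P : set adp) : Prop :=
  finite_set P /\ forall a, P a -> wf_adp a.

Definition subst_adp (sigma : substitution) (a : adp) : adp :=
  Adp (subst sigma (lhs a))
      [seq (pr.1, subst sigma pr.2) | pr <- rhs a] (flag a).

Definition flat_adp (a : adp) : adp :=
  Adp (lhs a) [seq (pr.1, flat pr.2) | pr <- rhs a] (flag a).

Definition normal_form (P : set adp) (t : term) : Prop :=
  forall a sigma pi,
    P a -> subterm_at (flat t) pi <> Some (subst sigma (lhs a)).

Definition ANF (P : set adp) : set term :=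
  [set t | forall pi u, pi <> [::] -> subterm_at t pi = Some u ->
             normal_form P u].

Definition redex (P : set adp) (s : term) (pi : position) (a : adp)
    (sigma : substitution) : Prop :=
  [/\ P a,
      defined_pos s pi,
      omap (@flat S V) (subterm_at s pi) = Some (subst sigma (lhs a)) &
      ANF P (subst sigma (lhs a))].

Inductive step_case := case_pr | case_p | case_r | case_irr.

Inductive step (P : set adp) (s : term) :
    step_case -> seq (R * term) -> Prop :=
| step_pr pi a sigma :
    redex P s pi a sigma -> annotated_pos s pi -> flag a = true ->
    step P s case_pr
      [seq (pr.1, replace_at s pi (subst sigma pr.2)) | pr <- rhs a]
| step_p pi a sigma :
    redex P s pi a sigma -> annotated_pos s pi -> flag a = false ->
    step P s case_p
      [seq (pr.1, flat_above pi (replace_at s pi (subst sigma pr.2)))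
         | pr <- rhs a]
| step_r pi a sigma :
    redex P s pi a sigma -> ~ annotated_pos s pi -> flag a = true ->
    step P s case_r
      [seq (pr.1, replace_at s pi (subst sigma (flat pr.2))) | pr <- rhs a]
| step_irr pi a sigma :
    redex P s pi a sigma -> ~ annotated_pos s pi -> flag a = false ->
    step P s case_irr
      [seq (pr.1, flat_above pi (replace_at s pi (subst sigma (flat pr.2))))
         | pr <- rhs a].

Record dtree := DTree {
  node : choiceType;
  edge : rel node;
  root : node;
  root_no_parent : forall v, ~~ edge v root;
  unique_parent : forall u v w, edge u w -> edge v w -> u = v;
  reachable : forall v, exists2 s, path edge root s & last root s = v }.

Definition inner (T : dtree) : set (node T) := [set v | exists w, edge v w].

Definition leaves (T : dtree) : set (node T) := ~` @inner T.

Definition enum_children (T : dtree) (v : node T) (ws : seq (node T)) : Prop :=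
  uniq ws /\ forall w, (w \in ws) = edge v w.

Record chain_tree (P : set adp) := ChainTree {
  ct_tree : dtree;
  ct_finite : forall v : node ct_tree, finite_set [set w | edge v w];
  ct_prob : node ct_tree -> R;
  ct_term : node ct_tree -> term;
  ct_prob_bound : forall v, 0 < ct_prob v <= 1;
  ct_prob_root : ct_prob (root ct_tree) = 1;
  ct_P : set (node ct_tree);
  ct_P_inner : ct_P `<=` @inner ct_tree;
  (* The enumeration [ws] is chosen to match the order in which the rule lists
     its multi-distribution. *)
  ct_step_P : forall v, ct_P v ->
    exists ws c, [/\ enum_children v ws, c = case_pr \/ c = case_p &
      step P (ct_term v) c
        [seq (ct_prob w / ct_prob v, ct_term w) | w <- ws]];
  ct_step_R : forall v, inner v -> ~ ct_P v ->
    exists ws c, [/\ enum_children v ws, c = case_r \/ c = case_irr &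
      step P (ct_term v) c
        [seq (ct_prob w / ct_prob v, ct_term w) | w <- ws]];
  ct_infinite : forall f : nat -> node ct_tree,
    (forall n, edge (f n) (f n.+1)) ->
    forall n, exists2 m, (n <= m)%N & ct_P (f m) }.

Definition leaf_mass (P : set adp) (T : chain_tree P) : \bar R :=
  \esum_(v in leaves (T := ct_tree T)) (ct_prob v)%:E.

Definition iAST (P : set adp) : Prop :=
  forall T : chain_tree P, leaf_mass T = 1%E.

Definition adp_vars (a : adp) : set V :=
  vars (lhs a) `|`
  [set x | exists j p r, onth (rhs a) j = Some (p, r) /\ vars r x].

Definition problem_vars (P : set adp) : set V :=
  [set x | exists2 a, P a & adp_vars a x].

Definition fresh_renaming (P : set adp) (rho : V -> V) : Prop :=
  (forall x y, problem_vars P x -> problem_vars P y ->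
     rho x = rho y -> x = y) /\
  (forall x, problem_vars P x -> ~ problem_vars P (rho x)).

Definition vr (rho : V -> V) (P : set adp) : set adp :=
  subst_adp (fun x => Var S (rho x)) @` P.

Definition defined_symbol (P : set adp) (g : asym S) : Prop :=
  exists2 a, P a & root_sym (lhs a) = Some g.

(* The subterm at position pi is replaced by the variable [nu pi], so that
   distinct occurrences get distinct variables when nu is injective. *)
Fixpoint Cap_at (P : set adp) (nu : position -> V) (pi : position) (t : term)
    : term :=
  match t with
  | Var x => Var S x
  | App g args =>
      if `[< defined_symbol P g >] then Var S (nu pi)
      else App g (fun i => Cap_at P nu (rcons pi (val i)) (args i))
  end.

Definition Cap (P : set adp) (nu : position -> V) (t : term) : term :=
  Cap_at P nu [::] t.

Definition fresh_cap_vars (P : set adp) (rho : V -> V) (nu : position -> V)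
    : Prop :=
  injective nu /\
  forall pi, ~ problem_vars P (nu pi) /\ ~ problem_vars (vr rho P) (nu pi).

Definition instances (P : set adp) (rho : V -> V) (nu : position -> V)
    (mgu : term -> term -> option substitution) (a : adp) : set adp :=
  [set c | exists a' j p' r' t delta,
    [/\ vr rho P a' /\ onth (rhs a') j = Some (p', r'),
        annotated_subterm t r',
        mgu (Cap P nu (sharp t)) (sharp (lhs a)) = Some delta,
        ANF P (subst delta (lhs a')) /\ ANF P (subst delta (lhs a)) &
        c = subst_adp delta a]].

End ADP.

(* Main.v *)
From Stdlib Require Import Eqdep_dec.
Require Import Defs.
From mathcomp Require Import all_boot all_order all_algebra.
From mathcomp Require Import all_classical all_reals all_analysis.

Set Implicit Arguments.
Unset Strict Implicit.
Unset Printing Implicit Defensive.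

Import Order.TTheory GRing.Theory Num.Theory.
Local Open Scope classical_set_scope.
Local Open Scope ring_scope.

(** Write [P] for the given problem and [Q] for the transformed one. They
    have the same normal forms, since the left-hand sides of [Q] are
    instances of those of [P] and [lhs a] is kept.

    A [Q]-chain tree becomes a [P]-chain tree with the same shape and
    probabilities by relabelling it with terms that carry more annotations.

    Conversely, consider a [P]-chain tree. An annotation in it either is one
    of the finitely many annotations of the term at the root, or it stems
    from an annotated subterm of some right-hand side, below which only
    innermost steps have taken place. In the latter case the redex matches
    [Cap] of that subterm, so a step with [a] at this position is also a
    step with an element of [instances]. Hence a step of the tree that is
    not a [Q]-step consumes an annotation of the root term. Cutting the tree
    at the first such steps leaves a [Q]-chain tree, of leaf mass 1, and the
    subtrees cut off have fewer old annotations; induction on the number of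
    old annotations concludes. *)

(** * Terms, positions and annotations *)

Section TermTheory.
Variables (S : signature) (V : Type).
Local Notation term := (term S V).
Implicit Types (s t u w : term) (pi tau : position) (g h : asym S).
Implicit Types (sigma kappa : substitution S V).

(** The argument vector depends on the symbol, so [injection] only yields an equality of dependent
    pairs; decidable equality of symbols turns it into one of vectors. *)
Lemma App_inj g (us vs : 'I_(aarity g) -> term) :
  App g us = App g vs -> us = vs.
Proof.
move=> e; injection e; apply: inj_pair2_eq_dec => g1 g2.
by case: (@eqP (sym S + {f : sym S | defined f})%type g1 g2); [left|right].
Qed.

Lemma subst_comp sigma kappa t :
  subst sigma (subst kappa t) = subst (fun x => subst sigma (kappa x)) t.
Proof. by elim: t => //= g ts IH; congr App; apply: funext => i. Qed.

Lemma eq_in_subst sigma kappa t :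
  (forall x, vars t x -> sigma x = kappa x) -> subst sigma t = subst kappa t.
Proof.
elim: t => /= [x ->//|g ts IH eq_sk]; congr App; apply: funext => i.
by apply: IH => x tx; apply: eq_sk; exists i.
Qed.

Lemma subst_Var t : subst (@Var S V) t = t.
Proof. by elim: t => //= g ts IH; congr App; apply: funext => i. Qed.

Lemma flat_idem t : flat (flat t) = flat t.
Proof. by elim: t => //= g ts IH; congr App; apply: funext => i. Qed.

Lemma flat_subst sigma t :
  flat (subst sigma t) = subst (fun x => flat (sigma x)) (flat t).
Proof. by elim: t => //= g ts IH; congr App; apply: funext => i. Qed.

Lemma vars_flat t : vars (flat t) = vars t.
Proof.
elim: t => //= g ts IH; apply/seteqP.
by split=> x [i xi]; exists i; [rewrite -IH|rewrite IH].
Qed.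

(** A redex is compared with a left-hand side after [flat]; this transfers the absence of
    annotations to the matching substitution. *)
Lemma flat_subst_inv sigma t x :
  flat (subst sigma t) = subst sigma t -> vars t x -> flat (sigma x) = sigma x.
Proof.
elim: t => [y|g ts IH] /=; first by move=> e ->.
move=> e [i xi]; have e1 : inl (flat_sym g) = g by case: e.
by case: g e1 ts IH e i xi => // f _ ts IH /App_inj e i; apply: IH; have :=
  congr1 (@^~ i) e.
Qed.

Lemma subterm_at_nil t : subterm_at t [::] = Some t.
Proof. by case: t. Qed.

Lemma replace_at_nil t u : replace_at t [::] u = u.
Proof. by case: t. Qed.

Lemma flat_above_nil t : flat_above [::] t = t.
Proof. by case: t. Qed.

Lemma subterm_at_ord g (ts : 'I_(aarity g) -> term) (i : 'I_(aarity g)) pi :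
  subterm_at (App g ts) (val i :: pi) = subterm_at (ts i) pi.
Proof. by rewrite /= valK. Qed.

Lemma subterm_at_consP g (ts : 'I_(aarity g) -> term) n pi u :
  subterm_at (App g ts) (n :: pi) = Some u ->
  exists2 i : 'I_(aarity g), n = val i & subterm_at (ts i) pi = Some u.
Proof. by move=> /=; case: insubP => // i _ <- e; exists i. Qed.

Lemma subterm_at_subst sigma t pi u :
  subterm_at t pi = Some u ->
  subterm_at (subst sigma t) pi = Some (subst sigma u).
Proof.
elim: pi t => [t|n pi IH [//|g ts]]; first by rewrite !subterm_at_nil => -[<-].
move=> /subterm_at_consP[i -> /IH e]; exact: (etrans (subterm_at_ord _ _ _)).
Qed.

Lemma subterm_at_flat t pi :
  subterm_at (flat t) pi = omap (@flat S V) (subterm_at t pi).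
Proof. by elim: pi t => [|n pi IH] [x|g ts] //=; case: insub => //=. Qed.

Lemma subterm_at_cat t pi tau :
  subterm_at t (pi ++ tau) = obind
    (fun v => subterm_at v tau) (subterm_at t pi).
Proof. by elim: pi t => [|n pi IH] [x|g ts] //=; case: insub => //=. Qed.

Lemma vars_subterm t pi u : subterm_at t pi = Some u -> vars u `<=` vars t.
Proof.
elim: pi t => [t|n pi IH [//|g ts]]; first by rewrite !subterm_at_nil => -[<-].
by move=> /subterm_at_consP[i _ /IH h] x /h; exists i.
Qed.

Lemma vars_position t x :
  vars t x -> exists pi, subterm_at t pi = Some (Var S x).
Proof.
elim: t => [y /= ->|g ts IH [i /IH[pi e]]]; first by exists [::].
by exists (val i :: pi); rewrite subterm_at_ord.
Qed.

Lemma annotated_pos_nil t : annotated_pos t [::] <-> is_annotated_root t.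
Proof.
by rewrite /annotated_pos/= subterm_at_nil; split=> [[_ [<-]]|]//; exists t.
Qed.

Lemma annotated_pos_ord g (ts : 'I_(aarity g) -> term) (i : 'I_(aarity g)) pi :
  annotated_pos (App g ts) (val i :: pi) = annotated_pos (ts i) pi.
Proof. by rewrite /annotated_pos /= valK. Qed.

Lemma annotated_pos_consP g (ts : 'I_(aarity g) -> term) n pi :
  annotated_pos (App g ts) (n :: pi) ->
  exists2 i : 'I_(aarity g), n = val i & annotated_pos (ts i) pi.
Proof. by case=> u /subterm_at_consP[i -> e] h; exists i => //; exists u. Qed.

Lemma annotated_pos_Var (x : V) pi : ~ annotated_pos (Var S x) pi.
Proof. by case=> u; case: pi => //= -[<-] [f]. Qed.

Lemma annotated_pos_flat t pi : ~ annotated_pos (flat t) pi.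
Proof.
elim: t pi => [x|g ts IH] pi; first exact: annotated_pos_Var.
case: pi => [/annotated_pos_nil[f]//|n pi].
by move=> /annotated_pos_consP[i _ /IH].
Qed.

Lemma unannotatedP t : unannotated t <-> flat t = t.
Proof.
split=> [|<-]; last by apply/seteqP; split=> pi // /annotated_pos_flat.
elim: t => //= g ts IH /seteqP[h _].
case: g ts IH h => [f|f] ts IH h; last first.
  by have /h : annotated_pos (App (inr f) ts) [::] by apply/annotated_pos_nil;
    exists f.
congr App; apply: funext => i; apply: IH; apply/seteqP; split=> pi // ti.
by apply: (h (val i :: pi)); rewrite annotated_pos_ord.
Qed.

Lemma flat_subterm t pi u :
  flat t = t -> subterm_at t pi = Some u -> flat u = u.
Proof.
by move=> <-; rewrite subterm_at_flat; case: subterm_at => //= v [<-];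
  rewrite flat_idem.
Qed.

(** No annotation can lie inside some [sigma x], so the descent along [pi] ends within [t]. *)
Lemma annotated_pos_subst sigma t pi u :
  (forall x, vars t x -> flat (sigma x) = sigma x) ->
  subterm_at (subst sigma t) pi = Some u -> is_annotated_root u ->
  exists v, [/\ subterm_at t pi = Some v, is_annotated_root v &
    u = subst sigma v].
Proof.
elim: t pi => [x|g ts IH] pi fs.
  move=> e ua; have : annotated_pos (sigma x) pi by exists u.
  by rewrite -fs// => /annotated_pos_flat.
case: pi => [[<-] [f /= [e]]|n pi].
  by exists (App g ts); split=> //; exists f; rewrite /= e.
move=> /subterm_at_consP[i -> e] ua.
have [v [ev va ->]] := IH i pi (fun x xi => fs x (ex_intro _ i xi)) e ua.
by exists v; rewrite subterm_at_ord.
Qed.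

Lemma flat_replace_at t pi u :
  flat (replace_at t pi u) = replace_at (flat t) pi (flat u).
Proof.
elim: pi t => [|n pi IH] [x|g ts] //=; congr App; apply: funext => i.
by case: ifP.
Qed.

Lemma flat_flat_above pi t : flat (flat_above pi t) = flat t.
Proof.
elim: pi t => [|n pi IH] [x|g ts] //=; congr App; apply: funext => i.
by case: ifP.
Qed.

Lemma annotated_pos_flat_above pi t tau :
  annotated_pos (flat_above pi t) tau <->
  annotated_pos t tau /\ (prefix tau pi -> tau = pi).
Proof.
elim: pi t tau => [|n pi IH] t tau.
  rewrite flat_above_nil; split=> [h|[]//]; split=> //; by case: tau h.
case: t => [x|g ts]; first by split=> [/annotated_pos_Var|[/annotated_pos_Var]].
case: tau => [|m tau].
  split=> [/annotated_pos_nil[f]//|[_ /(_ isT)]//].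
split.
- move=> /annotated_pos_consP[i -> ]; rewrite annotated_pos_ord /=.
  case: eqP => [<-|ne] => [/IH[h1 h2]|h]; split=> //.
  by move=> /= /h2 ->.
- move=> [/annotated_pos_consP[i -> h]] /=.
  rewrite (annotated_pos_ord (g := inl (flat_sym g))).
  case: eqP => [<-|//] /= h2; apply/IH; split=> // p.
  by have [] := h2 p.
Qed.

Lemma annotated_pos_replace_at t pi w tau u :
  subterm_at t pi = Some u ->
  annotated_pos (replace_at t pi w) tau <->
  (exists2 rho, tau = pi ++ rho & annotated_pos w rho) \/
  (~~ prefix pi tau /\ annotated_pos t tau).
Proof.
elim: pi t tau => [|n pi IH] t tau.
  move=> _; rewrite replace_at_nil prefix0s; split=> [h|[[rho ->]|[]]//].
  by left; exists tau.
case: t => [x|g ts] // /subterm_at_consP[i -> e].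
case: tau => [|m tau].
  split=> [/annotated_pos_nil [f h]|].
    by right; split=> //; apply/annotated_pos_nil; exists f.
  move=> [[]//|[_ /annotated_pos_nil [f h]]]; apply/annotated_pos_nil.
  by exists f.
split.
- move=> /annotated_pos_consP[j -> ]; rewrite annotated_pos_ord /=.
  case: eqP => [/val_inj->|ne]; rewrite ?eqxx /=.
    move=> /(IH _ _ e)[[rho -> h]|h]; last by right.
    by left; exists rho.
  by move=> h; right; rewrite eq_sym; move/eqP: ne => /negbTE ->.
- case=> [[rho [-> ->] h]|[np /annotated_pos_consP[j mj h]]].
    by rewrite annotated_pos_ord eqxx; apply/(IH _ _ e); left; exists rho.
  rewrite mj annotated_pos_ord /=; case: eqP => [/val_inj ij|//].
  rewrite ij; apply/(IH _ _ e); right; split; last by rewrite -ij.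
  by move: np; rewrite mj ij /= eqxx.
Qed.

End TermTheory.

(** * Existence of most general unifiers *)

Section Unification.
Variables (S : signature) (V : Type).
Local Notation term := (term S V).
Local Notation substitution := (substitution S V).
Implicit Types (s t u : term) (x y : V) (theta delta : substitution).

Fixpoint term_size t : nat :=
  match t with
  | Var _ => 1
  | App g ts => (\sum_(i < aarity g) term_size (ts i)).+1
  end.

Lemma term_size_gt0 t : (0 < term_size t)%N.
Proof. by case: t. Qed.

Lemma term_size_occurs theta t x :
  vars t x -> (term_size (theta x) <= term_size (subst theta t))%N.
Proof.
elim: t => [y /= ->//|g ts IH [i /IH h]] /=.
by rewrite (leq_trans h)// (bigD1 i)//= -addnS leq_addr.
Qed.

Lemma term_size_occurs_App theta g ts x :
  vars (App g ts) x ->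
  (term_size (theta x) < term_size (subst theta (App g ts)))%N.
Proof.
by move=> [i /(term_size_occurs theta) h] /=;
  rewrite ltnS (leq_trans h)// (bigD1 i)//= leq_addr.
Qed.

(** [V] is an arbitrary type, so variables are compared classically by [pselect]. *)
Definition single_subst x u : substitution :=
  fun y => if pselect (y = x) then u else Var S y.

Lemma subst_single_subst theta x u :
  theta x = subst theta u ->
  forall t, subst theta (subst (single_subst x u) t) = subst theta t.
Proof.
move=> e t; rewrite subst_comp; apply: eq_in_subst => y _.
by rewrite /single_subst; case: pselect => //= ->.
Qed.

Lemma single_subst_fresh x u t : ~ vars t x -> subst (single_subst x u) t = t.
Proof.
move=> nx; rewrite -[RHS]subst_Var; apply: eq_in_subst => y ty.
by rewrite /single_subst; case: pselect => // yx; case: nx; rewrite -yx.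
Qed.

Fixpoint unifies (E : seq (term * term)) theta : Prop :=
  if E is e :: E' then is_unifier e.1 e.2 theta /\ unifies E' theta else True.

Lemma unifies_cat E F theta :
  unifies (E ++ F) theta <-> unifies E theta /\ unifies F theta.
Proof.
by elim: E => [|e E IH] /=; [split=> [|[]]|rewrite IH; split;
  [case=> ? []|case=> -[]]].
Qed.

Lemma unifies_map (I : eqType) (r : seq I) (F : I -> term * term) theta :
  unifies [seq F i | i <- r] theta <->
  forall i, i \in r -> is_unifier (F i).1 (F i).2 theta.
Proof.
elim: r => [|i r IH] //=; rewrite IH; split.
  by move=> [h1 h2] j; rewrite in_cons => /predU1P[->//|/h2].
by move=> h; split=> [|j jr]; apply: h; rewrite inE ?eqxx// jr orbT.
Qed.

Definition subst_eqs sigma (E : seq (term * term)) :=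
  [seq (subst sigma e.1, subst sigma e.2) | e <- E].

Lemma unifies_subst_eqs theta sigma E :
  unifies (subst_eqs sigma E) theta <->
  unifies E (fun x => subst theta (sigma x)).
Proof.
by elim: E => //= e E IH; rewrite IH /is_unifier !subst_comp.
Qed.

Lemma eq_unifies theta delta E :
  (forall x, theta x = delta x) -> unifies E theta <-> unifies E delta.
Proof. by move=> /funext->. Qed.

(** A unifier [theta] makes both sides of an equation equally large, so measuring the left sides
    suffices. *)
Definition eqs_size theta (E : seq (term * term)) : nat :=
  \sum_(e <- E) term_size (subst theta e.1).

(* The recursion of Martelli-Montanari terminates on any problem that has a
   unifier [theta], because [eqs_size theta] decreases at every step;
   eliminating a variable leaves the [theta]-images of the rest unchanged. *)
Lemma unifies_mgu E theta : unifies E theta ->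
  exists2 delta, unifies E delta &
    forall theta', unifies E theta' ->
      forall x, theta' x = subst theta' (delta x).
Proof.
have [n] := ubnP (eqs_size theta E); elim: n E => // n IH [|[s t] E] le_n uE.
  by exists (@Var S V).
(* Variable elimination is stated apart from the orientation of the equation, since it serves a
   variable on either side. *)
have elimP x u : theta x = subst theta u -> ~ vars u x -> unifies E theta ->
    (eqs_size theta E < n)%N ->
  exists2 delta, is_unifier (Var S x) u delta /\ unifies E delta &
    forall theta', is_unifier (Var S x) u theta' /\ unifies E theta' ->
      forall y, theta' y = subst theta' (delta y).
  move=> exu nxu uE' len.
  have sE theta' : theta' x = subst theta' u ->
      unifies (subst_eqs (single_subst x u) E) theta' <-> unifies E theta'.
    move=> e; rewrite unifies_subst_eqs; apply: eq_unifies => y.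
    by rewrite -[single_subst x u y]/(subst (single_subst x u) (Var S y))
      subst_single_subst.
  have [||delta d1 d2] := IH (subst_eqs (single_subst x u) E).
  - rewrite /eqs_size big_map /= (eq_bigr
      (fun e => term_size (subst theta e.1)))//.
    by move=> e _; rewrite subst_single_subst.
  - exact/sE.
  exists (fun y => subst delta (single_subst x u y)).
    split; last exact/unifies_subst_eqs.
    rewrite /is_unifier -[LHS]subst_comp/=
      -subst_comp (single_subst_fresh _ nxu).
    by rewrite /single_subst; case: pselect.
  move=> theta' [u1 u2] y.
  have /(sE _ u1)/d2 h := u2.
  rewrite subst_comp -(@eq_in_subst _ _ theta')//.
  by rewrite -[single_subst x u y]/(subst (single_subst x u) (Var S y))
    subst_single_subst.
have {}le_n : (eqs_size theta E + term_size (subst theta s) <= n)%N.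
  by move: le_n; rewrite /eqs_size big_cons addnC ltnS.
have ltE : (eqs_size theta E < n)%N.
  apply: leq_trans le_n; rewrite -addn1 leq_add2l; exact: term_size_gt0.
move: uE => [/= u1 u2].
case: s le_n u1 => [x|g ss] le_n u1.
  have [xt|nxt] := pselect (vars t x); last exact: elimP.
  (* Occurs check: a proper occurrence of [x] in [t] would make the [theta]-image of [x] larger than
     itself. What remains is the trivial equation, which is dropped. *)
  case: t u1 xt => [y|h ts] u1 xt; last first.
    have := term_size_occurs_App theta xt.
    by rewrite -[subst theta (App _ _)]u1 /= ltnn.
  have {}xt : x = y by []; rewrite -xt.
  by have [delta d1 d2] := IH E ltE u2; exists delta => // theta' [_ /d2].
case: t u1 => [x|h ts] u1.
  have nx : ~ vars (App g ss) x.
    move=> /(term_size_occurs_App theta).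
    by rewrite [subst theta (App _ _)]u1 /= ltnn.
  have [delta [d1 d1'] d2] := elimP x (App g ss) (esym u1) nx u2 ltE.
  exists delta => [|theta' [v1 v2]]; first by split; first exact: esym.
  by apply: d2; split; first exact: esym.
have gh : g = h by case: u1.
case: h / gh ts u1 => ts u1.
(* Decomposition into the equations between arguments; the measure drops by one, for the lost root
   symbol. *)
pose F := [seq (ss i, ts i) | i <- enum 'I_(aarity g)] ++ E.
have FP th : unifies F th <->
    is_unifier (App g ss) (App g ts) th /\ unifies E th.
  rewrite unifies_cat unifies_map; split=> -[h1 h2]; split=> //.
    by rewrite /is_unifier /=; congr App; apply: funext => i; apply: h1;
      rewrite mem_enum.
  by move=> i _; have := congr1 (@^~ i) (App_inj h1).
have [||delta d1 d2] := IH F.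
- rewrite /eqs_size big_cat big_map big_enum /= addnC -addnS.
  exact: le_n.
- exact/FP.
by exists delta => [|th /FP]; [exact/FP|exact: d2].
Qed.

Lemma unifiable_mgu s t theta : is_unifier s t theta -> exists delta,
  is_mgu s t delta.
Proof.
move=> u; have [|delta [d1 _] d2] := @unifies_mgu [:: (s,
  t)] theta; first by [].
exists delta; split=> // theta' u'; exists theta' => x; exact: d2.
Qed.

End Unification.

(** * Replacement and comparison of annotations *)

Section Annotations.
Variables (S : signature) (V : Type).
Local Notation term := (term S V).
Implicit Types (s t u v w : term) (pi tau : position) (x : V).
Implicit Types (sigma kappa : substitution S V).

Lemma subterm_at_replace_in t pi w tau u :
  subterm_at t pi = Some u ->
  subterm_at (replace_at t pi w) (pi ++ tau) = subterm_at w tau.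
Proof.
elim: pi t => [|n pi IH] t; first by rewrite replace_at_nil.
case: t => [x|g ts] // /subterm_at_consP[i -> e].
by rewrite cat_cons [LHS](subterm_at_ord) eqxx (IH _ e).
Qed.

(** The second alternative is a replacement strictly below [tau]: an annotation at [tau] survives
    while its subterm is rewritten. *)
Lemma subterm_at_replace_out t pi w tau u :
  subterm_at t tau = Some u -> ~~ prefix pi tau ->
  subterm_at (replace_at t pi w) tau = Some u \/
  exists n rho, pi = tau ++ n :: rho /\
    subterm_at (replace_at t pi w) tau = Some (replace_at u (n :: rho) w).
Proof.
elim: pi t tau => [|n pi IH] t tau; first by rewrite prefix0s.
case: tau => [|m tau].
  rewrite subterm_at_nil => -[<-] _; right; exists n, pi.
  by rewrite subterm_at_nil.
case: t => [x|g ts] // /subterm_at_consP[i -> e] /= np.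
rewrite valK; case: eqP => [ni|_]; last by left.
move: np; rewrite -ni eqxx /= => np.
have [|[k [rho [-> h]]]] := IH _ _ e np; first by left.
by right; exists k, rho.
Qed.

(** Relates the label of a node in a chain tree for [Q] to its new label in the tree for [P]. *)
Definition annot_le t t' : Prop :=
  flat t = flat t' /\ annotated_pos t `<=` annotated_pos t'.

Lemma annot_le_refl t : annot_le t t.
Proof. by split. Qed.

Lemma annot_le_trans t u v : annot_le t u -> annot_le u v -> annot_le t v.
Proof.
by move=> [e1 s1] [e2 s2]; split; [rewrite e1|exact: subset_trans s1 s2].
Qed.

Lemma annot_le_defined t t' pi u :
  annot_le t t' -> subterm_at t pi = Some u ->
  exists2 u', subterm_at t' pi = Some u' & flat u' = flat u.
Proof.
move=> [e _] tu; have := congr1 (fun v => subterm_at v pi) e.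
rewrite !subterm_at_flat tu /=; case: subterm_at => //= u' [e'].
by exists u'.
Qed.

Lemma annot_le_replace t t' w w' pi u :
  annot_le t t' -> annot_le w w' -> subterm_at t pi = Some u ->
  annot_le (replace_at t pi w) (replace_at t' pi w').
Proof.
move=> le_t [ew sw] tu; have [u' tu' _] := annot_le_defined le_t tu.
case: le_t => et st; split; first by rewrite !flat_replace_at et ew.
move=> tau /(annotated_pos_replace_at w tau tu) h.
apply/(annotated_pos_replace_at w' tau tu').
by case: h => [[rho -> /sw ?]|[np /st ?]]; [left; exists rho|right].
Qed.

Lemma annot_le_flat_above t t' pi :
  annot_le t t' -> annot_le (flat_above pi t) (flat_above pi t').
Proof.
move=> [et st]; split; first by rewrite !flat_flat_above.
by move=> tau /annotated_pos_flat_above[/st h1 h2];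
  apply/annotated_pos_flat_above.
Qed.

Lemma flat_above_annot_le t pi : annot_le (flat_above pi t) t.
Proof.
split; first by rewrite flat_flat_above.
by move=> tau /annotated_pos_flat_above[].
Qed.

Lemma annot_le_subst_flat sigma t :
  annot_le (subst sigma (flat t)) (subst sigma t).
Proof.
split; first by rewrite !flat_subst flat_idem.
elim: t => [x|g ts IH] //= tau.
case: tau => [/annotated_pos_nil[f]//|n tau].
by move=> /annotated_pos_consP[i -> /IH]; rewrite annotated_pos_ord.
Qed.

Lemma subst_flat_subst sigma kappa t :
  (forall x, flat (kappa x) = kappa x) ->
  subst sigma (flat (subst kappa t)) =
  subst (fun x => subst sigma (kappa x)) (flat t).
Proof.
by move=> fk; rewrite flat_subst subst_comp;
  apply: eq_in_subst => x _; rewrite fk.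
Qed.

End Annotations.

(** Terms carry no [eqType] structure, so entries of a right-hand side are accessed by [onth] in
    place of [\in]. *)
Lemma eq_map_onth (A B C D : Type) (F : A * B -> C * D) (G : A * B ->
  C * D) (s : seq (A * B)) :
  (forall j p r, onth s j = Some (p, r) -> F (p, r) = G (p, r)) ->
  map F s = map G s.
Proof.
elim: s => //= -[p r] s IH h; rewrite (h 0 p r)// IH// => j; exact: (h j.+1).
Qed.

Lemma onth_mapP (A B : Type) (F : A -> B) (s : seq A) j y :
  onth (map F s) j = Some y -> exists2 x, onth s j = Some x & y = F x.
Proof. by elim: s j => [|x s IH] [|j] //=; [case=> <-; exists x|exact: IH]. Qed.

(** * Origin of annotations *)

Section Rewriting.
Variables (R : realType) (S : signature) (V : Type).
Local Notation term := (term S V).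
Local Notation adp := (adp R S V).
Implicit Types (P Q : set adp) (s t u v w : term) (pi tau : position) (x : V).
Implicit Types (sigma kappa delta : substitution S V) (a b c : adp).

Lemma wf_flat_lhs a : wf_adp a -> flat (lhs a) = lhs a.
Proof. by case=> /unannotatedP. Qed.

Lemma wf_lhs_App a : wf_adp a ->
  exists f ls, lhs a = App (inl f) ls /\ defined f.
Proof.
case=> /unannotatedP + + _ _; case: (lhs a) => [x _ [g]//|g ls e [h [<-] df]].
case: g ls e df => [f|f] ls e df; first by exists f, ls.
by case: e.
Qed.

Lemma normal_form_subst P kappa t :
  normal_form P (subst kappa t) -> normal_form P t.
Proof.
move=> h b sigma pi Pb e.
apply: (h b (fun x => subst (fun y => flat (kappa y)) (sigma x)) pi Pb).
by rewrite flat_subst (subterm_at_subst _ e) subst_comp.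
Qed.

Lemma ANF_subst P kappa t : ANF P (subst kappa t) -> ANF P t.
Proof.
move=> h pi u pi0 e; apply: (@normal_form_subst P kappa).
exact: h pi0 (subterm_at_subst kappa e).
Qed.

(** A left-hand side is not a variable, so [x] occurs strictly below its root and [sigma x] is a
    proper subterm of the instance. *)
Lemma ANF_lhs_var P a sigma x : wf_adp a ->
  ANF P (subst sigma (lhs a)) -> vars (lhs a) x -> normal_form P (sigma x).
Proof.
move=> wfa h vx; have [pi e] := vars_position vx.
apply: (h pi _ _ (subterm_at_subst sigma e)).
by move=> pi0; move: e; have [f [ls [-> _]]] := wf_lhs_App wfa; rewrite pi0.
Qed.

Lemma normal_form_lhs P Q t :
  (forall b, P b -> exists c kappa, Q c /\ lhs b = subst kappa (lhs c)) ->
  normal_form Q t -> normal_form P t.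
Proof.
move=> PQ h b sigma pi /PQ[c [kappa [Qc ->]]]; rewrite subst_comp;
  exact: (h c _ pi Qc).
Qed.

Lemma ANF_lhs P Q :
  (forall b, P b -> exists c kappa, Q c /\ lhs b = subst kappa (lhs c)) ->
  ANF Q `<=` ANF P.
Proof.
by move=> PQ t h pi u pi0 e; apply: normal_form_lhs PQ _; exact: h e.
Qed.

(* Over-approximates "[u] is a reduct of [subst sigma t]": the positions that
   [Cap] abstracts away are unconstrained. *)
Fixpoint cap_match P sigma t u : Prop :=
  match t with
  | Var x => u = sigma x
  | App g ts => defined_symbol P g \/
      exists2 us, u = App g us & forall i, cap_match P sigma (ts i) (us i)
  end.

Lemma cap_match_subst P sigma t : cap_match P sigma t (subst sigma t).
Proof.
by elim: t => //= g ts IH; right; exists (fun i => subst sigma (ts i)).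
Qed.

(** The redex cannot lie inside the image of a variable of [t], which is a normal form. If it is at
    the root, then the root symbol of [t] is defined and [Cap] abstracts it away; otherwise the
    claim passes to an argument. *)
Lemma cap_match_replace P sigma t u b kappa pi w :
  P b -> wf_adp b ->
  (forall x, vars t x -> normal_form P (sigma x)) -> flat u = u ->
  subterm_at u pi = Some (subst kappa (lhs b)) ->
  cap_match P sigma t u -> cap_match P sigma t (replace_at u pi w).
Proof.
move=> Pb wfb; elim: t u pi => [x|g ts IH] u pi nf fu e /=.
  by move=> eu; have := nf x erefl b kappa pi Pb; rewrite -eu fu e.
case=> [|[us eu h]]; [by left|].
case: pi e => [|n pi] e.
  left; exists b => //; move: e; rewrite subterm_at_nil eu => -[] /(congr1
    (@root_sym S V)).
  by have [f [ls [-> _]]] := wf_lhs_App wfb => /= ->.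
right; rewrite eu; exists (fun j => if val j ==
  n then replace_at (us j) pi w else us j) => // i.
case: eqP => [ni|_]; last exact: h.
apply: IH (h i); first by move=> x xi; apply: nf; exists i.
  by apply: (@flat_subterm _ _ u [:: val i]) => //;
    rewrite eu subterm_at_ord subterm_at_nil.
by move: e; rewrite eu -ni subterm_at_ord.
Qed.

(* [u] is what an annotated subterm of a right-hand side may have become by
   innermost rewriting strictly below its root. *)
Definition arises P u : Prop :=
  exists b j p r, (P b /\ onth (rhs b) j = Some (p, r)) /\
  exists pi v sigma,
  [/\ subterm_at r pi = Some v /\ is_annotated_root v,
      ANF P (subst sigma (lhs b)),
      forall x, vars (lhs b) x -> flat (sigma x) = sigma x &
      exists g ts us, [/\ flat v = App g ts, u = App g us &
        forall i, cap_match P sigma (ts i) (us i)]].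

(** The position [n :: pi] is strictly below the root, so only one argument changes. Its variables
    are instantiated by normal forms because the step that created the annotation was innermost. *)
Lemma arises_replace P u b kappa n pi w :
  (forall c, P c -> wf_adp c) -> P b -> flat u = u ->
  subterm_at u (n :: pi) = Some (subst kappa (lhs b)) ->
  arises P u -> arises P (replace_at u (n :: pi) w).
Proof.
move=> wfP Pb fu e [c [j [p [r [[Pc cr] [tau [v [sigma [[rv va] anf fs [g [ts
  [us [ev eu h]]]]]]]]]]]]].
exists c, j, p, r; split=> //; exists tau, v, sigma; split=> //.
exists g, ts, (fun j => if val j == n then replace_at (us j) pi w else us j).
split=> //; first by rewrite eu.
move=> i; case: eqP => [ni|_]; last exact: h.
apply: (@cap_match_replace _ _ _ _ b kappa) (h i) => //; first exact: wfP.
- move=> x xi; apply: ANF_lhs_var anf _; first exact: wfP.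
  have [_ _ _ /(_ _ _ _ cr)] := wfP _ Pc; apply; apply: (vars_subterm rv).
  by rewrite -vars_flat ev; exists i.
- by apply: (@flat_subterm _ _ u [:: val i]) => //;
    rewrite eu subterm_at_ord subterm_at_nil.
- by move: e; rewrite eu -ni subterm_at_ord.
Qed.

(** Base case, for annotations just created: [sigma] contributes none, so each one stems from [r],
    and nothing has been rewritten below it yet. *)
Lemma arises_rhs P b j p r sigma pi u :
  P b -> wf_adp b -> onth (rhs b) j = Some (p, r) ->
    ANF P (subst sigma (lhs b)) ->
  (forall x, vars (lhs b) x -> flat (sigma x) = sigma x) ->
  subterm_at (subst sigma r) pi = Some u -> is_annotated_root u ->
  arises P (flat u).
Proof.
move=> Pb [_ _ _ /(_ _ _ _) rl] br anf fs e ua.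
have fsr x : vars r x -> flat (sigma x) = sigma x by move=> /(rl _ _ _ br)/fs.
have [v [rv va ->]] := annotated_pos_subst fsr e ua.
exists b, j, p, r; split=> //; exists pi, v, sigma; split=> //.
case: v rv va {e} => [x _ [f]//|g vs] rv _.
exists (inl (flat_sym g)), (fun i => flat (vs i)),
  (fun i => subst sigma (flat (vs i))).
split=> //=; last by move=> i; exact: cap_match_subst.
congr App; apply: funext => i; rewrite flat_subst; apply: eq_in_subst => x.
rewrite vars_flat => xi; apply: fsr; apply: (vars_subterm rv); by exists i.
Qed.

(** [O] lists the positions whose annotations may be old, that is, inherited from the term where the
    observation started. *)
Definition annot_origin P (O : seq position) s : Prop :=
  forall tau, annotated_pos s tau ->
    tau \in O \/ exists2 u, subterm_at (flat s) tau = Some u & arises P u.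

Lemma annot_origin_le P O s s' :
  annot_le s s' -> annot_origin P O s' -> annot_origin P O s.
Proof. by move=> [e h] o tau /h /o; rewrite e. Qed.

(** Annotations inside [w] are accounted for by the last hypothesis; those elsewhere were present in
    [s] and keep their origin, by [arises_replace] if they lie above [pi]. An annotation at [pi]
    itself now comes from [w], whence [pi] leaves [O]. *)
Lemma annot_origin_replace P O s pi b sigma w :
  (forall c, P c -> wf_adp c) -> redex P s pi b sigma ->
  annot_origin P O s ->
  (forall tau u, subterm_at w tau = Some u -> is_annotated_root u ->
     arises P (flat u)) ->
  annot_origin P [seq tau <- O | tau != pi] (replace_at s pi w).
Proof.
move=> wfP [Pb [v sv _] sb _] o aw tau.
rewrite sv /= in sb; case: sb => sb.
move=> /(annotated_pos_replace_at w tau sv)[[rho -> [u wu ua]]|[np st]].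
  right; exists (flat u); last exact: aw wu ua.
  by rewrite subterm_at_flat (subterm_at_replace_in _ _ sv) wu.
have [tO|[u su ar]] := o _ st.
  left; rewrite mem_filter tO andbT; apply: contraNneq np => ->.
  exact: prefix_refl.
right; rewrite flat_replace_at.
have [h|[n [rho [epi ->]]]] := subterm_at_replace_out (flat w) su np.
  by exists u.
eexists; first by [].
apply: (@arises_replace P u b sigma) ar => //;
  first exact: flat_subterm (flat_idem _) su.
have : subterm_at (flat s) pi = Some (subst sigma (lhs b))
  by rewrite subterm_at_flat sv -sb.
by rewrite epi subterm_at_cat su.
Qed.

Lemma redex_flat P s pi b sigma :
  redex P s pi b sigma -> forall x, vars (lhs b) x -> flat (sigma x) = sigma x.
Proof.
move=> [_ _ + _] x; case: subterm_at => //= v [e]; apply: flat_subst_inv.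
by rewrite -e flat_idem.
Qed.

Definition P_case (k : step_case) := k = case_pr \/ k = case_p.

Definition R_case (k : step_case) := k = case_r \/ k = case_irr.

Lemma step_case_split k : P_case k \/ R_case k.
Proof. by case: k; rewrite /P_case /R_case; intuition. Qed.

(** Covers uniformly the three ways in which a rule [c] of [Q] stems from a rule [b] of [P]: [h] is
    the identity, [flat] or [subst kappa]. The two [annot_le] conditions serve steps at annotated
    and at unannotated positions. *)
Definition adp_simulates b c : Prop :=
  exists kappa (h : term -> term),
  [/\ lhs c = subst kappa (lhs b), flag c = flag b,
      rhs c = [seq (pr.1, h pr.2) | pr <- rhs b],
      forall sigma r,
        annot_le (subst sigma (h r))
                 (subst (fun x => subst sigma (kappa x)) r) &
      forall sigma r,
        annot_le (subst sigma (flat (h r)))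
                 (subst (fun x => subst sigma (kappa x)) (flat r))].

Lemma adp_simulates_refl b : adp_simulates b b.
Proof.
exists (@Var S V), id; split=> //; try by move=> *; exact: annot_le_refl.
  by rewrite subst_Var.
by rewrite -[LHS]map_id; apply: eq_map => -[].
Qed.

Lemma adp_simulates_flat b : adp_simulates b (flat_adp b).
Proof.
exists (@Var S V), (@flat S V); split=> //=.
- by rewrite subst_Var.
- by move=> sigma r; exact: annot_le_subst_flat.
- by move=> sigma r; rewrite flat_idem; exact: annot_le_refl.
Qed.

Lemma adp_simulates_subst b kappa :
  (forall x, flat (kappa x) = kappa x) -> adp_simulates b (subst_adp kappa b).
Proof.
move=> fk; exists kappa, (subst kappa); split=> //= sigma r.
  by rewrite subst_comp; exact: annot_le_refl.
by rewrite subst_flat_subst//; exact: annot_le_refl.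
Qed.

(** The same position is rewritten in [s']. It may be annotated there although it is not in [s], so
    an R-step can become a P-step but not conversely; this direction preserves the condition on
    infinite paths. Both distributions are images of one list [L], so that they correspond entry by
    entry. *)
Lemma step_simulation P Q s s' k mu :
  (forall c, Q c -> exists2 b, P b & adp_simulates b c) -> ANF Q `<=` ANF P ->
  step Q s k mu -> annot_le s s' ->
  exists k' (L : seq (R * term)) F F',
  [/\ step P s' k' [seq (pr.1, F' pr.2) | pr <- L],
      P_case k -> P_case k',
      mu = [seq (pr.1, F pr.2) | pr <- L] &
      forall r, annot_le (F r) (F' r)].
Proof.
move=> QP anf st le_s.
have redexP pi c sigma : redex Q s pi c sigma ->
    (exists u, subterm_at s pi = Some u) /\ exists2 b, P b &
    exists kappa h,
  [/\ redex P s' pi b (fun x => subst sigma (kappa x)), flag c = flag b,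
      rhs c = [seq (pr.1, h pr.2) | pr <- rhs b],
      forall r,
        annot_le (subst sigma (h r))
                 (subst (fun x => subst sigma (kappa x)) r) &
      forall r,
        annot_le (subst sigma (flat (h r)))
                 (subst (fun x => subst sigma (kappa x)) (flat r))].
  move=> [Qc [u su du] e an]; split; first by exists u.
  have [b Pb [kappa [h [el ef er h1 h2]]]] := QP _ Qc.
  exists b => //; exists kappa, h; split=> //.
  have [u' su' eu] := annot_le_defined le_s su.
  move: e an; rewrite el subst_comp su => -[e] an; split=> //.
  - exists u' => //; case: du => g gu dg.
    move: eu gu; case: u {su e} => //= g0 us; case: u' {su'} => //=
      g1 us' eg [eg'].
    exists g1 => //; rewrite -eg' in dg.
    by have [->] := congr1 (@root_sym S V) eg.
  - by rewrite su' /= eu e.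
  - exact: anf.
have leR pi sigma kappa (h : term -> term) :
    (exists u, subterm_at s pi = Some u) ->
    (forall r, annot_le (subst sigma (h r)) (subst kappa r)) -> forall r,
    annot_le (replace_at s pi (subst sigma (h r))) (replace_at s' pi (subst
      kappa r)).
  by move=> [u su] h1 r; exact: annot_le_replace le_s (h1 r) su.
have leF pi sigma kappa (h : term -> term) :
    (exists u, subterm_at s pi = Some u) ->
    (forall r, annot_le (subst sigma (flat (h r))) (subst kappa (flat r))) ->
      forall r,
    annot_le (replace_at s pi (subst sigma (flat (h r)))) (replace_at s' pi
      (subst kappa (flat r))).
  by move=> [u su] h1 r; exact: annot_le_replace le_s (h1 r) su.
(* The case of an R-step turned into a P-step: only the larger term receives the annotations of the
   right-hand side. *)
have leFR pi sigma kappa (h : term -> term) :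
    (exists u, subterm_at s pi = Some u) ->
    (forall r, annot_le (subst sigma (flat (h r))) (subst kappa (flat r))) ->
      forall r,
    annot_le (replace_at s pi (subst sigma (flat (h r)))) (replace_at s' pi
      (subst kappa r)).
  move=> [u su] h1 r; apply: annot_le_replace le_s _ su.
  exact: annot_le_trans (h1 r) (annot_le_subst_flat _ _).
have [_ an_s] := le_s.
case: st => pi c sigma /redexP[su [b Pb [kappa [h [rd ef er h1 h2]]]]] an fl;
  rewrite ef in fl; rewrite er -map_comp /=;
  pose ks x := subst sigma (kappa x).
- exists case_pr, (rhs b),
      (fun r => replace_at s pi (subst sigma (h r))),
      (fun r => replace_at s' pi (subst ks r)); split.
  + exact: step_pr rd (an_s _ an) fl.
  + by [].
  + by [].
  + exact: leR.
- exists case_p, (rhs b),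
      (fun r => flat_above pi (replace_at s pi (subst sigma (h r)))),
      (fun r => flat_above pi (replace_at s' pi (subst ks r))); split.
  + exact: step_p rd (an_s _ an) fl.
  + by [].
  + by [].
  + by move=> r; apply: annot_le_flat_above; exact: leR.
- have [an'|an'] := pselect (annotated_pos s' pi).
    exists case_pr, (rhs b),
      (fun r => replace_at s pi (subst sigma (flat (h r)))),
      (fun r => replace_at s' pi (subst ks r)); split.
    + exact: step_pr rd an' fl.
    + by case.
    + by [].
    + exact: leFR.
  exists case_r, (rhs b),
      (fun r => replace_at s pi (subst sigma (flat (h r)))),
      (fun r => replace_at s' pi (subst ks (flat r))); split.
  + exact: step_r rd an' fl.
  + by case.
  + by [].
  + exact: leF.
- have [an'|an'] := pselect (annotated_pos s' pi).
    exists case_p, (rhs b),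
      (fun r => flat_above pi (replace_at s pi (subst sigma (flat (h r))))),
      (fun r => flat_above pi (replace_at s' pi (subst ks r))); split.
    + exact: step_p rd an' fl.
    + by case.
    + by [].
    + by move=> r; apply: annot_le_flat_above; exact: leFR.
  exists case_irr, (rhs b),
      (fun r => flat_above pi (replace_at s pi (subst sigma (flat (h r))))),
      (fun r => flat_above pi (replace_at s' pi (subst ks (flat r)))); split.
  + exact: step_irr rd an' fl.
  + by case.
  + by [].
  + by move=> r; apply: annot_le_flat_above; exact: leF.
Qed.

End Rewriting.

(** * Converting steps of the original problem *)

Section Conversion.
Variables (R : realType) (S : signature) (V : Type).
Local Notation term := (term S V).
Local Notation adp := (adp R S V).
Variables (P Q : set adp).
Hypothesis wfP : forall b, P b -> wf_adp b.
Hypothesis ANF_PQ : ANF P `<=` ANF Q.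
(** Serves steps at unannotated positions, which see right-hand sides only up to [flat]. *)
Hypothesis flat_PQ : forall b, P b -> exists2 c, Q c &
  [/\ lhs c = lhs b, flag c = flag b &
      [seq (pr.1, flat pr.2) | pr <- rhs c] = [seq (pr.1,
        flat pr.2) | pr <- rhs b]].
(** Serves steps at annotated positions whose annotation is not an old one. *)
Hypothesis arises_PQ : forall b sigma, P b -> ANF P (subst sigma (lhs b)) ->
  arises P (subst sigma (lhs b)) ->
  exists2 c, Q c & exists kappa,
  [/\ subst kappa (lhs c) = subst sigma (lhs b), flag c = flag b &
      [seq (pr.1, subst kappa pr.2) | pr <- rhs c] =
      [seq (pr.1, subst sigma pr.2) | pr <- rhs b]].

Lemma annot_origin_contractum s O pi b sigma j p r :
  annot_origin P O s -> redex P s pi b sigma -> onth (rhs b) j = Some (p, r) ->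
  annot_origin P [seq tau <- O | tau != pi] (replace_at s pi (subst sigma r)).
Proof.
move=> o rd br; have [Pb _ _ an] := rd.
apply: (annot_origin_replace wfP rd o) => tau u.
exact: (arises_rhs Pb (wfP Pb) br an (redex_flat rd)).
Qed.

Lemma annot_origin_flat_contractum s O pi b sigma j p r :
  annot_origin P O s -> redex P s pi b sigma -> onth (rhs b) j = Some (p, r) ->
  annot_origin P [seq tau <- O | tau != pi]
    (replace_at s pi (subst sigma (flat r))).
Proof.
move=> o rd br; apply: (annot_origin_le _ (annot_origin_contractum o rd br)).
case: rd => _ [u su _] _ _; apply: annot_le_replace su;
  first exact: annot_le_refl.
exact: annot_le_subst_flat.
Qed.

Lemma step_annot_origin s k mu O : step P s k mu -> annot_origin P O s ->
  exists2 O', (size O' <= size O)%N &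
    forall j p t, onth mu j = Some (p, t) -> annot_origin P O' t.
Proof.
move=> st o; case: st => pi b sigma rd an fl;
  exists [seq tau <- O | tau != pi]; rewrite ?size_filter ?count_size//;
    move=> j p t e;
  have [[p' r'] br /= [_ ->]] := onth_mapP e;
    try apply: annot_origin_le (flat_above_annot_le _ _) _.
- exact: annot_origin_contractum rd br.
- exact: annot_origin_contractum rd br.
- exact: annot_origin_flat_contractum rd br.
- exact: annot_origin_flat_contractum rd br.
Qed.

(** At an unannotated position [flat_PQ] applies. At an annotated one outside [O] the redex arises
    from a right-hand side and [arises_PQ] applies; inside [O], the step removes [pi] from [O]. *)
Lemma step_conversion s k mu O : step P s k mu -> annot_origin P O s ->
  step Q s k mu \/
  exists2 O', (size O' < size O)%N &
    forall j p t, onth mu j = Some (p, t) -> annot_origin P O' t.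
Proof.
move=> st o.
have size_rem pi : pi \in O -> (size [seq tau <- O | tau != pi] < size O)%N.
  move=> piO; rewrite size_filter -(count_predC (fun tau => tau != pi) O).
  by rewrite -addn1 leq_add2l -has_count; apply/hasP; exists pi;
    rewrite //= negbK.
have convP pi b sigma : redex P s pi b sigma ->
  annotated_pos s pi -> pi \notin O ->
    exists2 c, Q c & exists kappa, [/\ redex Q s pi c kappa, flag c = flag b &
      [seq (pr.1, subst kappa pr.2) | pr <- rhs c] =
      [seq (pr.1, subst sigma pr.2) | pr <- rhs b]].
  move=> [Pb [u su du] e an] an_pi piO.
  have [|[v sv ar]] := o _ an_pi; first by rewrite (negbTE piO).
  move: sv; rewrite subterm_at_flat e => -[ev]; rewrite -ev in ar.
  have [c Qc [kappa [e1 e2 e3]]] := arises_PQ Pb an ar.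
  exists c => //; exists kappa; split=> //; split=> //; rewrite ?e1//.
    by exists u.
  exact: ANF_PQ.
have convR pi b sigma : redex P s pi b sigma ->
    exists2 c, Q c & [/\ redex Q s pi c sigma, flag c = flag b &
      [seq (pr.1, flat pr.2) | pr <- rhs c] = [seq (pr.1,
        flat pr.2) | pr <- rhs b]].
  move=> [Pb d e an]; have [c Qc [e1 e2 e3]] := flat_PQ Pb.
  by exists c => //; split=> //; split=> //; rewrite ?e1//; exact: ANF_PQ.
(* Each resulting distribution factors through the list of contracta, so equal lists of contracta
   give the same step. *)
pose G F (pr : R * term) := (pr.1, F pr.2) : R * term.
case: st => pi b sigma rd an fl.
- have [piO|piO] := boolP (pi \in O).
    right; exists [seq tau <- O | tau != pi] => [|j p t e];
      first exact: size_rem.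
    by have [[p' r'] br /= [_ ->]] := onth_mapP e;
      exact: annot_origin_contractum rd br.
  left; have [c Qc [kappa [rd' ef er]]] := convP _ _ _ rd an piO.
  rewrite -ef in fl; have := step_pr rd' an fl.
  rewrite (map_comp (G (replace_at s pi)) (G (subst kappa)))
    [map (G _) (rhs c)]er.
  by rewrite -map_comp.
- have [piO|piO] := boolP (pi \in O).
    right; exists [seq tau <- O | tau != pi] => [|j p t e];
      first exact: size_rem.
    have [[p' r'] br /= [_ ->]] := onth_mapP e.
    apply: annot_origin_le (flat_above_annot_le _ _) _.
    exact: annot_origin_contractum rd br.
  left; have [c Qc [kappa [rd' ef er]]] := convP _ _ _ rd an piO.
  rewrite -ef in fl; have := step_p rd' an fl.
  rewrite (map_comp (G
    (fun t => flat_above pi (replace_at s pi t))) (G (subst kappa)))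
      [map (G _) (rhs c)]er.
  by rewrite -map_comp.
- left; have [c Qc [rd' ef er]] := convR _ _ _ rd.
  rewrite -ef in fl; have := step_r rd' an fl.
  rewrite (map_comp (G
    (fun t => replace_at s pi (subst sigma t))) (G (@flat S V)))
      [map (G _) (rhs c)]er.
  by rewrite -map_comp.
- left; have [c Qc [rd' ef er]] := convR _ _ _ rd.
  rewrite -ef in fl; have := step_irr rd' an fl.
  rewrite (map_comp (G
    (fun t => flat_above pi (replace_at s pi (subst sigma t)))) (G (@flat S
      V))) [map (G _) (rhs c)]er.
  by rewrite -map_comp.
Qed.

End Conversion.

(** * Instances of the transformed rule *)

Section Instances.
Variables (R : realType) (S : signature) (V : Type).
Local Notation term := (term S V).
Local Notation adp := (adp R S V).
Implicit Types (P : set adp) (t u : term) (pi : position).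

Lemma annotate_root_App (f : sym S) (df : defined f)
    (ts : 'I_(aarity (inl f)) -> term) :
  annotate_root (App (inl f) ts) =
  App (inr (exist (fun f => is_true (defined f)) f df)) ts.
Proof.
rewrite /=; case: pselect => // df'.
by have -> : df' = df by exact: bool_irrelevance.
Qed.

Lemma flat_eq_subst kappa t :
  flat (subst kappa t) = subst kappa t -> flat t = t.
Proof.
elim: t => [//|g ts IH] /= e; have e1 : inl (flat_sym g) = g by case: e.
case: g e1 ts IH e => // f _ ts IH /App_inj e.
by congr App; apply: funext => i; apply: IH; have := congr1 (@^~ i) e.
Qed.

Lemma flat_Cap_at P nu pi t :
  flat (Cap_at P nu pi (flat t)) = Cap_at P nu pi (flat t).
Proof.
elim: t pi => [//|g ts IH] pi /=; case: asboolP => // _ /=.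
by congr App; apply: funext => i.
Qed.

(** Guarantees that [Cap] never abstracts away the annotated root of [sharp t]. *)
Lemma defined_symbol_inr P F : (forall b, P b -> wf_adp b) ->
  ~ defined_symbol P (inr F).
Proof. by move=> wfP [b /wfP/wf_lhs_App[f [ls [-> _]]]]. Qed.

Lemma sharp_flat_annotated t :
  is_annotated_root t ->
  exists F ts, sharp (flat t) = App (inr F) (fun i => flat (ts i)).
Proof.
rewrite /sharp flat_idem; case: t => [x [f]//|g ts [F [eF]]].
case: g ts eF => // -[f df] ts _; exists (exist _ f df), ts.
exact: annotate_root_App.
Qed.

Lemma sharp_lhs (a : adp) : wf_adp a ->
  exists F ts, sharp (lhs a) = App (inr F) (fun i => flat (ts i)).
Proof.
move=> wfa; have := wf_flat_lhs wfa; have [f [ls [-> df]]] :=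
  wf_lhs_App wfa => e.
by exists (exist _ f df), ls; rewrite /sharp /= -annotate_root_App.
Qed.

(* The terms unified in [instances] carry annotations at the roots only, so that
   erasing the annotations of a unifier yields a unifier. *)
Lemma instances_flat P rho nu mgu (a c : adp) :
  (forall b, P b -> wf_adp b) -> P a -> mgu_choice mgu ->
  instances P rho nu mgu a c ->
  exists2 delta, forall x, flat (delta x) = delta x & c = subst_adp delta a.
Proof.
move=> wfP Pa Hmgu [a' [j [p' [r' [t [delta [_ [pi [u [[u' su' au'] su ->]]] em
  _ ->]]]]]]].
exists delta => // x.
have {}au' : is_annotated_root u by move: su'; rewrite su => -[->].
have := Hmgu (Cap P nu (sharp (flat u))) (sharp (lhs a));
  rewrite em => -[ud md].
have [F [ts eF]] := sharp_flat_annotated au'.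
have [G [ls eG]] := sharp_lhs (wfP _ Pa).
move: ud md; rewrite eF eG /Cap /=; case: asboolP => [/defined_symbol_inr//|_].
rewrite /is_unifier /= => ud md.
have FG : F = G by case: ud.
case: G / FG ls ud md {eG} => ls ud md.
(* The flattened [delta] is again a unifier, hence an instance of [delta]. So each [delta x] has an
   unannotated instance and is itself unannotated. *)
have [|kappa k] := md (fun x => flat (delta x)).
  congr App; apply: funext => i.
  rewrite -[flat (ls i)]flat_idem -flat_Cap_at -!flat_subst.
  by have := congr1 (@^~ i) (App_inj ud) => /= ->.
by apply: (@flat_eq_subst kappa); rewrite -k flat_idem.
Qed.

(** The cap variable of a position receives the subterm of [u] found there, and [cap_match] says
    that [u] agrees with [t] everywhere else. *)
Lemma subst_Cap_at P nu rho sigma theta t u pi :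
  (forall x, vars t x -> theta (rho x) = sigma x) ->
  (forall tau w, subterm_at u tau = Some w -> theta (nu (pi ++ tau)) = w) ->
  cap_match P sigma t u ->
  subst theta (Cap_at P nu pi (subst (fun x => Var S (rho x)) t)) = u.
Proof.
elim: t u pi => [x|g ts IH] u pi hr hn /=; first by move=> ->; exact: hr.
case: asboolP => [d _|nd [//|[us eu h]]] /=.
  by rewrite -[pi]cats0; apply: hn; rewrite subterm_at_nil.
rewrite eu; congr App; apply: funext => i; apply: IH => //.
  by move=> x xi; apply: hr; exists i.
by move=> tau w e; rewrite cat_rcons; apply: hn; rewrite eu subterm_at_ord.
Qed.

Lemma adp_vars_lhs P (b : adp) x : P b -> vars (lhs b) x -> problem_vars P x.
Proof. by move=> Pb bx; exists b => //; left. Qed.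

Lemma arises_instance P rho nu mgu (a : adp) sigma :
  (forall b, P b -> wf_adp b) -> P a ->
  fresh_renaming P rho -> fresh_cap_vars P rho nu -> mgu_choice mgu ->
  ANF P (subst sigma (lhs a)) -> arises P (subst sigma (lhs a)) ->
  exists delta kappa, instances P rho nu mgu a (subst_adp delta a) /\
    forall x, vars (lhs a) x -> sigma x = subst kappa (delta x).
Proof.
move=> wfP Pa [rho_inj rho_fresh] [nu_inj nu_fresh] Hmgu an.
move=> [b [j [p [r [[Pb br] [tau [v [sigma' [[rv va] an' fs [g [ts [us [ev eu
  h]]]]]]]]]]]]].
set u := subst sigma (lhs a) in an eu.
(* The unifier [theta] is glued from [sigma] on the variables of [P], [sigma'] on the renamed ones
   and the subterms of [u] on the cap variables. Freshness makes these three domains disjoint, and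
   injectivity makes each part well defined. *)
have /choice[theta ht] (y : V) : exists z : term,
    [/\ problem_vars P y -> z = sigma y,
        forall x, problem_vars P x -> y = rho x -> z = sigma' x &
        forall pi w, y = nu pi -> subterm_at u pi = Some w -> z = w].
  have rho_vr x : problem_vars P x -> problem_vars (vr rho P) (rho x).
    move=> [c Pc cx]; exists (subst_adp (fun x => Var S (rho x)) c);
      first by exists c.
    case: cx => [cx|[k [q [t [ct tx]]]]]; [left|right].
      have [pi e] := vars_position cx.
      by apply: (vars_subterm (subterm_at_subst (fun x => Var S (rho x)) e)).
    exists k, q, (subst (fun x => Var S (rho x)) t);
      rewrite onth_map ct; split=> //.
    have [pi e] := vars_position tx.
    by apply: (vars_subterm (subterm_at_subst (fun x => Var S (rho x)) e)).
  have [Py|nPy] := pselect (problem_vars P y).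
    exists (sigma y); split=> // [x Px e|pi w e _].
      by have := rho_fresh x Px; rewrite -e.
    by have [] := nu_fresh pi; rewrite -e.
  have [[x Px ey]|nx] := pselect (exists2 x, problem_vars P x & y = rho x).
    exists (sigma' x); split=> // [x' Px' e|pi w e _].
      by congr sigma'; apply: rho_inj => //; rewrite -ey.
    by have [_ []] := nu_fresh pi; rewrite -e ey; exact: rho_vr.
  have [[[pi w] [ey uw]]|nw] := pselect (exists q, y =
    nu q.1 /\ subterm_at u q.1 = Some q.2).
    exists w; split=> // [x Px e|pi' w' e e']; first by case: nx; exists x.
    have epi : pi' = pi by apply: nu_inj; rewrite -e.
    by move: e'; rewrite epi uw => -[].
  exists (Var S y); split=> // [x Px e|pi w e e']; first by case: nx; exists x.
  by case: nw; exists (pi, w).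
have t1 y : problem_vars P y -> theta y = sigma y by have [] := ht y.
have t2 x : problem_vars P x -> theta (rho x) = sigma' x.
  by move=> Px; have [_ /(_ x Px erefl)] := ht (rho x).
have t3 pi w : subterm_at u pi = Some w -> theta (nu pi) = w.
  by have [_ _ /(_ pi w erefl)] := ht (nu pi).
have rb x : vars r x -> problem_vars P x.
  by have [_ _ _ /(_ _ _ _ br) rl] := wfP _ Pb; move=> /rl; exact: adp_vars_lhs.
pose rs x := Var S (rho x).
have uni : is_unifier (Cap P nu (sharp (subst rs (flat v)))) (sharp (lhs a))
    theta.
  have [f [ls [el df]]] := wf_lhs_App (wfP _ Pa).
  have la i x : vars (ls i) x -> problem_vars P x.
    by move=> xi; apply: adp_vars_lhs Pa _; rewrite el; exists i.
  have va' x : vars (flat v) x -> problem_vars P x.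
    by rewrite vars_flat => /(vars_subterm rv); exact: rb.
  rewrite /u el /= in eu.
  have efg : inl f = g by have [->] := congr1 (@root_sym S V) eu.
  case: g / efg ts us ev eu h => ts us ev eu h.
  have {}eu := App_inj eu.
  rewrite /is_unifier /sharp wf_flat_lhs; last exact: wfP.
  rewrite el ev annotate_root_App.
  have -> : flat (subst rs (App (inl f) ts)) =
    App (inl f) (fun i => subst rs (ts i)).
    by rewrite -[RHS]/(subst rs (App (inl f) ts)) -ev flat_subst flat_idem.
  rewrite annotate_root_App /Cap /=; case: asboolP => [/defined_symbol_inr//|_].
  rewrite /=; congr App; apply: funext => i.
  rewrite (@subst_Cap_at _ _ _ sigma' _ _ (us i))//.
  - rewrite -eu; apply: eq_in_subst => x xi; rewrite t1//; exact: la xi.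
  - by move=> x xi; apply: t2; apply: va'; rewrite ev; exists i.
  - move=> tau' w e; apply: t3; rewrite -e -eu /u el.
    exact: (@subterm_at_ord _ _ (inl f)).
have := Hmgu (Cap P nu (sharp (subst rs (flat v)))) (sharp (lhs a)).
case em : mgu => [delta|]; last by have := unifiable_mgu uni.
move=> [_ /(_ _ uni)[kappa k]].
have sk t : subst kappa (subst delta t) = subst theta t.
  by rewrite subst_comp; apply: eq_in_subst => x _; rewrite k.
exists delta, kappa; split; last first.
  by move=> x xa; rewrite -k t1//; exact: adp_vars_lhs xa.
exists (subst_adp rs b), j, p, (subst rs r), (subst rs (flat v)),
  delta; split=> //.
- split; first by exists b.
  by rewrite onth_map br.
- exists tau, (subst rs v); split; last 1 first.
  + by rewrite flat_subst.
  + exists (subst rs v); first exact: subterm_at_subst.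
    by case: va => f; case: (v) => //= g0 vs [eg]; exists f; rewrite /= eg.
  + exact: subterm_at_subst.
(* Under [theta], a further instance of [delta], both left-hand sides are the argument normal forms
   known from the hypotheses. *)
- split; apply: (@ANF_subst _ _ _ _ kappa); rewrite sk.
  + rewrite /= subst_comp (@eq_in_subst _ _ _ sigma')// => x xb /=.
    by apply: t2; exact: adp_vars_lhs xb.
  + rewrite (@eq_in_subst _ _ _ sigma)// => x xa.
    by apply: t1; exact: adp_vars_lhs xa.
Qed.

End Instances.

(** * Trees *)

Section Trees.
Variable T : dtree.
Implicit Types u v w x : node T.

Inductive descendant u : node T -> Prop :=
| descendant_refl : descendant u u
| descendant_edge x w : descendant u x -> edge x w -> descendant u w.

Lemma descendant_trans u v w :
  descendant u v -> descendant v w -> descendant u w.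
Proof. by move=> uv; elim=> // x y _ ux; exact: descendant_edge. Qed.

Lemma edge_descendant u v : edge u v -> descendant u v.
Proof. exact: descendant_edge (descendant_refl u). Qed.

Lemma descendant_path u s : path (@edge T) u s -> descendant u (last u s).
Proof.
elim: s u => [|w s IH] u /=; first by constructor.
by move=> /andP[/edge_descendant uw /IH]; exact: descendant_trans.
Qed.

Lemma descendant_root v : descendant (Defs.root T) v.
Proof. by have [s /descendant_path + <-] := reachable v. Qed.

Lemma descendant_headP u w :
  descendant u w -> u = w \/ exists2 x, edge u x & descendant x w.
Proof.
elim=> [|x y _ [->|[z uz zx]] xy]; [by left| |].
  by right; exists y => //; constructor.
by right; exists z => //; exact: descendant_edge xy.
Qed.

Lemma descendant_tailP u w :
  descendant u w -> u = w \/ exists2 x, descendant u x & edge x w.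
Proof. by case=> [|x y ux xy]; [left|right; exists x]. Qed.

Lemma descendant_parent u v w :
  edge v w -> descendant u w -> u = w \/ descendant u v.
Proof.
move=> vw /descendant_tailP[|[x ux xw]]; first by left.
by right; rewrite (unique_parent vw xw).
Qed.

(** By induction from the root: as parents are unique, a cycle through [y] also passes through its
    parent, and the root has none. *)
Lemma edge_acyclic v w : edge v w -> ~ descendant w v.
Proof.
elim: (descendant_root v) w => [|x y _ IH xy] w.
  move=> rw /descendant_tailP[wr|[x _ xr]].
    by have := root_no_parent (Defs.root T); rewrite -{2}wr rw.
  by have := root_no_parent x; rewrite xr.
move=> yw wy; have yy : descendant y x.
  have [wy'|wx] := descendant_parent xy wy.
    have xy' : x = y by apply: unique_parent xy _; rewrite -{2}wy'.
    by rewrite xy'; constructor.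
  exact: descendant_trans (edge_descendant yw) wx.
exact: IH xy yy.
Qed.

Lemma descendant_antisym u v : descendant u v -> descendant v u -> u = v.
Proof.
move=> /descendant_headP[//|[x ux xv]] vu.
by case: (edge_acyclic ux); exact: descendant_trans xv vu.
Qed.

Lemma descendant_comparable u v w :
  descendant u w -> descendant v w -> descendant u v \/ descendant v u.
Proof.
move=> uw; elim: uw v => [|x y ux IH xy] v vy; first by right.
have [->|/IH//] := descendant_parent xy vy.
by left; exact: descendant_edge xy.
Qed.

Lemma children_disjoint v u w x : edge v u -> edge v w ->
  descendant u x -> descendant w x -> u = w.
Proof.
move=> vu vw ux wx.
have [|] := descendant_comparable ux wx.
  by move=> /(descendant_parent vw)[//|/(edge_acyclic vu)].
by move=> /(descendant_parent vu)[//|/(edge_acyclic vw)].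
Qed.

(** The paths are compared from their ends, where parents are unique. *)
Lemma root_path_unique s1 s2 : path (@edge T) (Defs.root T) s1 ->
  path (@edge T) (Defs.root T) s2 ->
  last (Defs.root T) s1 = last (Defs.root T) s2 -> s1 = s2.
Proof.
elim/last_ind: s1 s2 => [|s1 x IH]; elim/last_ind => [|s2 y _] //.
- rewrite rcons_path last_rcons => _ /andP[_ h] e.
  by move: h (root_no_parent (last (Defs.root T) s2)); rewrite -e /= => ->.
- rewrite rcons_path last_rcons => /andP[_ h] _ e.
  by move: h (root_no_parent (last (Defs.root T) s1)); rewrite e /= => ->.
rewrite !rcons_path !last_rcons => /andP[p1 e1] /andP[p2 e2] xy.
by rewrite xy in e1 *; rewrite (IH s2)//; exact: unique_parent e1 e2.
Qed.

End Trees.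

(** * Relabelling chain trees *)

Section Relabel.
Variables (R : realType) (S : signature) (V : Type).
Local Notation term := (term S V).
Local Notation adp := (adp R S V).

(** Distinctness of the children lets their new labels be chosen independently, even when [L] has
    repeated entries. *)
Lemma map_simulation (A : eqType) (ws : seq A) (q : A -> R) (t : A -> term)
    (L : seq (R * term)) F F' : uniq ws ->
  [seq (q w, t w) | w <- ws] = [seq (pr.1, F pr.2) | pr <- L] ->
  (forall r, annot_le (F r) (F' r)) ->
  exists f, [seq (q w, f w) | w <- ws] = [seq (pr.1, F' pr.2) | pr <- L] /\
    forall w, w \in ws -> annot_le (t w) (f w).
Proof.
move=> + + FF'; elim: ws L => [|w ws IH] [|[p r] L] //=; first by exists t.
move=> /andP[wws uws] [qw tw /(IH _ uws)[f [ef fle]]].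
exists (fun x => if x == w then F' r else f x); rewrite eqxx qw; split.
  rewrite -ef; congr cons; apply/eq_in_map => x xws.
  by case: eqP => // xw; rewrite xw (negbTE wws) in xws.
move=> x; rewrite inE; case: eqP => [->|_ /= xws]; last exact: fle.
by rewrite tw.
Qed.

Variables (P Q : set adp).
Hypothesis sim_PQ : forall s s' k mu, step Q s k mu -> annot_le s s' ->
  exists k' (L : seq (R * term)) F F',
  [/\ step P s' k' [seq (pr.1, F' pr.2) | pr <- L],
      P_case k -> P_case k',
      mu = [seq (pr.1, F pr.2) | pr <- L] &
      forall r, annot_le (F r) (F' r)].

Lemma chain_tree_simulation (T : chain_tree Q) :
  exists T' : chain_tree P, leaf_mass T' = leaf_mass T.
Proof.
pose N := node (ct_tree T); pose r0 : N := Defs.root (ct_tree T).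
(* [G (v, s)] proposes labels for the children of [v] once [v] has been relabelled by [s]. *)
have /choice[G HG] (q : N * term) : exists f : N -> term,
    inner q.1 -> annot_le (ct_term q.1) q.2 ->
    exists ws k, [/\ enum_children q.1 ws, ct_P q.1 -> P_case k,
      step P q.2 k [seq (ct_prob w / ct_prob q.1, f w) | w <- ws] &
      forall w, edge q.1 w -> annot_le (ct_term w) (f w)].
  case: q => v s /=.
  have [[iv le_vs]|nv] := pselect (inner v /\ annot_le (ct_term v) s);
    last first.
    by exists (fun=> s) => iv le_vs; case: nv.
  have [ws [k [ews kP st]]] : exists ws k, [/\ enum_children v ws,
      ct_P v -> P_case k & step Q (ct_term v) k
        [seq (ct_prob w / ct_prob v, ct_term w) | w <- ws]].
    have [Pv|nPv] := pselect (ct_P v).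
      by have [ws [k [h1 h2 h3]]] := ct_step_P Pv; exists ws, k.
    by have [ws [k [h1 h2 h3]]] := ct_step_R iv nPv; exists ws, k.
  have [k' [L [F [F' [st' kk' eL FF']]]]] := sim_PQ st le_vs.
  have [uws mws] := ews.
  have [f [ef fle]] := map_simulation uws eL FF'.
  exists f => _ _; exists ws, k'; split=> //; rewrite ?ef//;
    first by move=> /kP/kk'.
  by move=> w vw; apply: fle; rewrite mws.
have /choice[pt Hpt] (v : N) : exists s,
  path (@edge (ct_tree T)) r0 s /\ last r0 s = v.
  by have [s h1 h2] := reachable v; exists s.
pose stepG (q : N * term) w := (w, G q w).
(* The label of [v] is obtained by iterating [G] along the path from the root to [v]. *)
pose lab v := (foldl stepG (r0, ct_term r0) (pt v)).2.
have fold1 s q : (foldl stepG q s).1 = last q.1 s.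
  by elim: s q => [|w s IH] q //=; rewrite IH.
have pt_edge u w : edge u w -> pt w = rcons (pt u) w.
  move=> uw; have [h1 h2] := Hpt u; have [h3 h4] := Hpt w.
  apply: root_path_unique => //; last by rewrite last_rcons.
  by rewrite rcons_path h1 [last _ _]h2.
have lab_edge u w : edge u w -> lab w = G (u, lab u) w.
  move=> uw; rewrite /lab (pt_edge _ _ uw) -cats1 foldl_cat /=; congr (G _ w).
  have [_ h] := Hpt u.
  by rewrite [LHS]surjective_pairing fold1 /= h.
have lab_le v : annot_le (ct_term v) (lab v).
  elim: (descendant_root v) => [|x y _ IH xy].
    have -> : lab (Defs.root (ct_tree T)) = ct_term r0.
      rewrite /lab; have [h1 h2] := Hpt (Defs.root (ct_tree T)).
      by have -> : pt (Defs.root (ct_tree T)) = [::] by exact: root_path_unique.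
    exact: annot_le_refl.
  have ix : inner x by exists y.
  by have [ws [k [_ _ _]]] := HG (x, lab x) ix IH;
    rewrite (lab_edge _ _ xy); apply.
have labP v : inner v -> exists ws k, [/\ enum_children v ws,
  ct_P v -> P_case k &
    step P (lab v) k [seq (ct_prob w / ct_prob v, lab w) | w <- ws]].
  move=> iv; have [ws [k [h1 h2 h3 _]]] := HG (v, lab v) iv (lab_le v).
  exists ws, k; split=> //.
  have -> // : [seq (ct_prob w / ct_prob v, lab w) | w <- ws] =
          [seq (ct_prob w / ct_prob v, G (v, lab v) w) | w <- ws].
  by apply/eq_in_map => w; have [_ ->] := h1 => /lab_edge->.
(* This may exceed the set of P-nodes of [T], because some R-steps have become P-steps. *)
pose P' : set N := [set v | inner v /\ exists ws k,
  [/\ enum_children v ws, P_case k &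
    step P (lab v) k [seq (ct_prob w / ct_prob v, lab w) | w <- ws]]].
unshelve eexists.
  refine (@ChainTree R S V P (ct_tree T) (@ct_finite _ _ _ _ T)
    (@ct_prob _ _ _ _ T) lab
    (@ct_prob_bound _ _ _ _ T) (@ct_prob_root _ _ _ _ T) P' _ _ _ _).
  - by move=> v [].
  - by move=> v [_].
  - move=> v iv nv; have [ws [k [h1 h2 h3]]] := labP v iv.
    exists ws, k; split=> //; have [kP|//] := step_case_split k.
    by case: nv; split=> //; exists ws, k.
  - move=> f ef n; have [m nm Pm] := ct_infinite ef n; exists m => //.
    have im : inner (f m) by exists (f m.+1).
    have [ws [k [h1 h2 h3]]] := labP _ im.
    by split=> //; exists ws, k; split=> //; exact: h2.
by [].
Qed.

End Relabel.

(** * Leaf mass *)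

Lemma ler_sum_subset (R : numDomainType) (I : eqType) (s1 s2 : seq I)
    (F : I -> R) :
  uniq s1 -> {subset s1 <= s2} -> (forall i, 0 <= F i) ->
  \sum_(i <- s1) F i <= \sum_(i <- s2) F i.
Proof.
move=> + + F0; elim: s1 s2 => [|x s1 IH] s2 /=.
  by move=> _ _; rewrite big_nil; apply: sumr_ge0.
move=> /andP[xs1 us1] s12.
have xs2 : x \in s2 by apply: s12; rewrite inE eqxx.
rewrite (perm_big _ (perm_to_rem xs2)) !big_cons lerD2l; apply: IH => // y ys1.
apply: rem_mem; last by apply: s12; rewrite inE ys1 orbT.
by apply: contraNneq xs1 => <-.
Qed.

Lemma esum_subset (R : realType) (I : choiceType) (A B : set I)
    (F : I -> \bar R) :
  A `<=` B -> (\esum_(i in A) F i <= \esum_(i in B) F i)%E.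
Proof.
move=> AB; apply: ge_ereal_sup => _ [X [finX XA] <-]; apply: esum_ge.
by exists X => //; split=> //; exact: subset_trans XA AB.
Qed.

Lemma esum_divr_ge (R : realType) (I : choiceType) (D : set I) (F : I ->
  R) (c : R) :
  0 < c -> (forall i, 0 <= F i) -> (\esum_(i in D) (F i / c)%:E = 1)%E ->
  (c%:E <= \esum_(i in D) (F i)%:E)%E.
Proof.
move=> c0 F0 e; rewrite -[c%:E]mule1 -lee_pdivlMl// -e.
apply: ge_ereal_sup => _ [X [finX XD] <-].
rewrite (eq_fsbigr (fun i => (c^-1)%:E * (F i)%:E)%E); last first.
  by move=> i _; rewrite -EFinM mulrC.
rewrite -ge0_mule_fsumr; last by move=> i; rewrite lee_fin.
apply: lee_pmul => //; first by rewrite lee_fin invr_ge0 ltW.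
  by rewrite fsbig_finite//; apply: sume_ge0 => i _; rewrite lee_fin.
by apply: esum_ge; exists X.
Qed.

Section Mass.
Variables (R : realType) (S : signature) (V : Type).
Local Notation term := (term S V).
Local Notation adp := (adp R S V).
Variable P : set adp.
Hypothesis wfP : forall b, P b -> wf_adp b.

Lemma step_mass (s : term) k mu : step P s k mu -> \sum_(pr <- mu) pr.1 = 1.
Proof.
by case=> pi a sigma [/wfP[_ _ [_ sum1] _] _ _ _] _ _; rewrite big_map.
Qed.

Variable T : chain_tree P.
Local Notation N := (node (ct_tree T)).
Local Notation prob := (@ct_prob _ _ _ _ T).
Implicit Types u v w x : N.

Lemma prob_gt0 v : 0 < prob v.
Proof. by have /andP[] := ct_prob_bound v. Qed.

Lemma prob_ge0 v : 0 <= prob v.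
Proof. exact: ltW (prob_gt0 v). Qed.

Lemma inner_step v : inner v -> exists ws k,
  [/\ enum_children v ws, (ct_P v /\ P_case k) \/ (~ ct_P v /\ R_case k) &
      step P (ct_term v) k [seq (prob w / prob v, ct_term w) | w <- ws]].
Proof.
move=> iv; have [Pv|nPv] := pselect (ct_P v).
  by have [ws [k [h1 h2 h3]]] := ct_step_P Pv; exists ws, k; split=> //; left.
by have [ws [k [h1 h2 h3]]] := ct_step_R iv nPv; exists ws, k;
  split=> //; right.
Qed.

Lemma children_mass v : inner v ->
  exists2 ws, enum_children v ws & \sum_(w <- ws) prob w = prob v.
Proof.
move=> /inner_step[ws [k [ews _ /step_mass]]]; rewrite big_map /=
  -mulr_suml => e.
exists ws => //; apply: (@mulIf _ (prob v)^-1);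
  first by rewrite invr_neq0// gt_eqF// prob_gt0.
by rewrite e divff// gt_eqF// prob_gt0.
Qed.

Lemma prob_descendant v w : descendant v w -> prob w <= prob v.
Proof.
elim=> // x y _ IH xy; apply: le_trans IH.
have [|ws [uws mws] <-] := @children_mass x; first by exists y.
by rewrite (bigD1_seq y) ?mws//= lerDl; apply: sumr_ge0 => z _; exact: prob_ge0.
Qed.

(** A finite set of leaves has bounded depth, and the leaves up to a given depth weigh at most as
    much as the root. *)
Lemma leaf_mass_le1 : (leaf_mass T <= 1)%E.
Proof.
have /choice[ch Hch] v : exists ws, inner v ->
    enum_children v ws /\ \sum_(w <- ws) prob w = prob v.
  have [/children_mass[ws h1 h2]|nv] := pselect (inner v); first by exists ws.
  by exists [::].
(* [lv k v] enumerates the leaves at depth at most [k] below [v]; inner nodes at depth [k] are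
   discarded. *)
pose fix lv (k : nat) v {struct k} : seq N := if pselect (inner v) then
  (if k is k'.+1 then flatten [seq lv k' w | w <- ch v] else [::]) else [:: v].
have lv_le k v : \sum_(w <- lv k v) prob w <= prob v.
  elim: k v => [|k IH] v /=; case: pselect => iv;
    rewrite ?big_seq1 ?big_nil ?prob_ge0//.
  have [_ <-] := Hch v iv; rewrite big_flatten big_map; exact: ler_sum.
have lv_mem k v s : path (@edge (ct_tree T)) v s -> leaves (last v s) ->
    (size s <= k)%N -> last v s \in lv k v.
  have lv0 j x : leaves x -> x \in lv j x.
    by move=> lx; case: j => [|j] /=; case: pselect => [ix|nx];
      by [case: (lx ix)|rewrite inE].
  elim: k v s => [|k IH] v [|w s]; [by move=> _ /lv0|by []|by move=> _ /lv0|].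
  rewrite /=.
  move=> /andP[vw pw] lf sk; case: pselect => [iv|[]]; last by exists w.
  have [[_ mws] _] := Hch v iv.
  by apply/flatten_mapP; exists w; rewrite ?mws//; exact: IH.
have /choice[pt Hpt] v : exists s,
    path (@edge (ct_tree T)) (Defs.root (ct_tree T)) s /\ last (Defs.root
      (ct_tree T)) s = v.
  by have [s h1 h2] := reachable v; exists s.
apply: ge_ereal_sup => _ [X [finX XL] <-].
rewrite fsbig_finite// sumEFin lee_fin.
pose k := (\max_(x <- finmap.enum_fset (fset_set X)) size (pt x))%N.
rewrite -(ct_prob_root T); apply: le_trans (lv_le k _).
apply: ler_sum_subset; [exact: finmap.fset_uniq| |exact: prob_ge0].
move=> x xX; have [h1 h2] := Hpt x; rewrite -{1}h2; apply: lv_mem => //.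
  by rewrite h2; apply: XL; apply/set_mem; rewrite -(in_fset_set finX).
by apply: (@leq_bigmax_seq _ _ xpredT).
Qed.

Definition mass_below v : \bar R :=
  \esum_(w in [set w | leaves w /\ descendant v w]) (prob w)%:E.

(** No node lies below two elements of [K], so the masses below these elements sum over disjoint
    sets of leaves below [v]. *)
Lemma mass_below_ge (K : set N) v : (forall u, K u -> descendant v u) ->
  (forall u1 u2 x, K u1 -> K u2 -> descendant u1 x ->
    descendant u2 x -> u1 = u2) ->
  (forall u, K u -> ((prob u)%:E <= mass_below u)%E) ->
  (\esum_(u in K) (prob u)%:E <= mass_below v)%E.
Proof.
move=> Kv Kdisj Kmass.
pose J u := [set w | K u /\ (leaves w /\ descendant u w)].
apply: (@le_trans _ _ (\esum_(u in K) \esum_(w in J u) (prob w)%:E)%E).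
  apply: le_esum => u Ku; apply: le_trans (Kmass _ Ku) _.
  by apply: esum_subset => w [].
rewrite (@esum_esum _ _ _ K J (fun _ w => (prob w)%:E)); last first.
  by move=> u w _ _; rewrite lee_fin prob_ge0.
rewrite -(@esum_image _ _ _ (K `*`` J) snd (fun w => (prob w)%:E)).
  apply: esum_subset => _ [[u w] [/= Ku [_ [lw uw]]] <-]; split=> //.
  exact: descendant_trans (Kv _ Ku) uw.
move=> [u1 w1] [u2 w2] /set_mem[/= K1 [_ [_ h1]]] /set_mem[/= K2 [_ [_ h2]]] ew.
by rewrite -ew in h2 *; rewrite (Kdisj _ _ _ K1 K2 h1 h2).
Qed.

Lemma mass_below_inner v : inner v ->
  (forall w, edge v w -> ((prob w)%:E <= mass_below w)%E) ->
  ((prob v)%:E <= mass_below v)%E.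
Proof.
move=> iv ch; have [ws [uws mws] <-] := children_mass iv.
apply: (@le_trans _ _ (\esum_(w in [set` ws]) (prob w)%:E)%E).
  rewrite esum_fset; [|exact: finite_seq|by move=> *; rewrite lee_fin prob_ge0].
  by rewrite -fsbig_seq// sumEFin.
apply: mass_below_ge => [u|u1 u2 x|u] /=.
- by rewrite mws; exact: edge_descendant.
- by rewrite !mws; exact: children_disjoint.
- by rewrite mws; exact: ch.
Qed.

Definition step_ok (Q : set adp) v := exists ws k,
  [/\ enum_children v ws, (ct_P v /\ P_case k) \/ (~ ct_P v /\ R_case k) &
      step Q (ct_term v) k [seq (prob w / prob v, ct_term w) | w <- ws]].

End Mass.

Lemma annotated_pos_finite (S : signature) (V : Type) (t : term S V) :
  exists O : seq position, forall tau, annotated_pos t tau -> tau \in O.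
Proof.
elim: t => [x|g ts /choice[A HA]].
  by exists [::] => tau h; case: (annotated_pos_Var h).
exists ([::] :: flatten [seq [seq val i :: tau | tau <- A i] | i <- enum
  'I_(aarity g)]).
move=> [|n tau]; first by rewrite inE.
move=> h; have [i -> /HA hi] := annotated_pos_consP h; rewrite inE /=.
apply/flatten_mapP; exists i; first by rewrite mem_enum.
by apply/mapP; exists tau.
Qed.

(** * Cutting chain trees into regions *)

Section Region.
Variables (R : realType) (S : signature) (V : Type).
Local Notation adp := (adp R S V).
Variables P Q : set adp.
Hypothesis wfP : forall b, P b -> wf_adp b.
Hypothesis iAST_Q : iAST Q.
Variable T : chain_tree P.
Local Notation N := (node (ct_tree T)).
Local Notation prob := (@ct_prob _ _ _ _ T).
Implicit Types u v w x : N.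

Lemma region_mass (D : set N) v :
  D v -> (forall w, D w -> descendant v w) ->
  (forall w, D w -> w = v \/ exists2 u, D u & edge u w) ->
  (forall u w, D u -> D w -> edge u w ->
     step_ok Q u /\ forall w', edge u w' -> D w') ->
  ((prob v)%:E <=
   \esum_(u in [set u | D u /\ ~ exists2 w, D w & edge u w]) (prob u)%:E)%E.
Proof.
move=> Dv Dd Dp De.
(* Boolean membership makes [M] a subtype of the nodes, with its choice structure. *)
pose M := {w : N | w \in D}.
pose e' : rel M := fun y z => edge (val y) (val z).
pose inD w (Dw : w \in D) : M := @exist N (fun w => w \in D) w Dw.
pose r' : M := inD v (mem_set Dv).
have DM (x : M) : D (val x) by apply: set_mem; exact: valP.
have no_parent (x : M) : ~~ e' x r'.
  by apply/negP => /edge_acyclic; apply; apply: Dd; exact: DM.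
have uniq_parent (x y z : M) : e' x z -> e' y z -> x = y.
  by move=> xz yz; apply: val_inj; exact: unique_parent xz yz.
have reach (x : M) : exists2 s, path e' r' s & last r' s = x.
  case: x => w Dw; have vw := Dd w (set_mem Dw).
  elim: vw Dw => [|u y _ IH uy] Dw.
    by exists [::] => //; exact: val_inj.
  have [yv|[u' Du' uy']] := Dp y (set_mem Dw).
    by exists [::] => //; apply: val_inj; rewrite /= yv.
  have uu' : u = u' by exact: unique_parent uy uy'.
  rewrite -uu' in Du'; have [s ps ls] := IH (mem_set Du').
  exists (rcons s (inD y Dw)); last by rewrite last_rcons.
  by rewrite rcons_path ps ls.
pose T' := @DTree M e' r' no_parent uniq_parent reach.
have inner_ok (x : M) : @inner T' x -> exists ws k,
    [/\ @enum_children T' x ws,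
     (ct_P (val x) /\ P_case k) \/ (~ ct_P (val x) /\ R_case k) &
      step Q (ct_term (val x)) k
        [seq ((prob (val y) / prob v) / (prob (val x) / prob v),
          ct_term (val y))
           | y : M <- ws]].
  move=> [y xy]; have [[ws [k [[uws mws] kP st]]] chD] :=
    De _ _ (DM x) (DM y) xy.
  have ews : [seq val y | y : M <- (pmap insub ws : seq M)] = ws.
    rewrite (pmap_filter (@insubK _ _ M)); apply/all_filterP/allP => w.
    by rewrite mws => /chD Dw /=; rewrite insubT//; exact: mem_set.
  exists (pmap insub ws), k; split=> //.
    by split=> [|y']; [exact: pmap_sub_uniq|rewrite mem_pmap_sub mws].
  move: st; rewrite -{1}ews -map_comp; congr step; apply: eq_map => z /=.
  by rewrite invf_div mulrA divfK// gt_eqF// prob_gt0.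
(* Division by [prob v] gives the root probability 1 and cancels in the quotients of the steps.
   Nodes on the lower border of [D] become leaves, so they no longer count as P-nodes. *)
unshelve epose (C := @ChainTree R S V Q T' _
  (fun x : M => prob (val x) / prob v)
  (fun x : M => ct_term (val x)) _ _ [set x : M | @inner T' x /\ ct_P (val x)]
    _ _ _ _).
- move=> x; apply: (@finite_preimage _ _ [set w | edge (val x) w]
    (val : M -> N)).
    by move=> y z _ _; exact: val_inj.
  exact: ct_finite.
- move=> x /=; rewrite divr_gt0 ?prob_gt0//= ler_pdivrMr ?prob_gt0// mul1r.
  by apply: prob_descendant => //; apply: Dd; exact: DM.
- by rewrite /= divff// gt_eqF// prob_gt0.
- by move=> x [].
- move=> x [/inner_ok[ws [k [h1 h2 h3]]] Px]; exists ws, k; split=> //.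
  by case: h2 => -[].
- move=> x ix nx; have [ws [k [h1 h2 h3]]] := inner_ok _ ix;
    exists ws, k; split=> //.
  by case: h2 => -[] // Px; case: nx.
- move=> f ef n; have [m nm Pm] := @ct_infinite _ _ _ _ T
    (fun i => val (f i)) ef n.
  by exists m => //; split=> //; exists (f m.+1).
have := iAST_Q C; rewrite /leaf_mass /= => mass1.
have := esum_divr_ge (prob_gt0 v) (fun x : M => prob_ge0 (val x)) mass1.
move=> /le_trans; apply.
rewrite -(@esum_image _ M N (leaves (T :=
  T')) val (fun w => (prob w)%:E)); last first.
  by move=> x y _ _; exact: val_inj.
apply: esum_subset => _ [x lx <-]; split; first exact: DM.
by move=> [w Dw xw]; apply: lx; exists (inD w (mem_set Dw)).
Qed.

Hypothesis origin_step : forall s k mu A, step P s k mu -> annot_origin P A s ->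
  exists2 A', (size A' <= size A)%N &
    forall j p t, onth mu j = Some (p, t) -> annot_origin P A' t.

Hypothesis conversion : forall s k mu A, step P s k mu -> annot_origin P A s ->
  step Q s k mu \/
  exists2 A', (size A' < size A)%N &
    forall j p t, onth mu j = Some (p, t) -> annot_origin P A' t.

Lemma onth_children v w ws : enum_children v ws -> edge v w ->
  exists j, onth [seq (prob w / prob v, ct_term w) | w <- ws] j =
    Some (prob w / prob v, ct_term w).
Proof.
move=> [_ mws]; rewrite -mws => /onthP[j e].
by exists j; rewrite onth_map e.
Qed.

Lemma annot_origin_descendant v w A :
  annot_origin P A (ct_term v) -> descendant v w ->
  exists2 A', (size A' <= size A)%N & annot_origin P A' (ct_term w).
Proof.
move=> ov; elim=> [|x y _ [A' sA' oA'] xy]; first by exists A.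
have ix : inner x by exists y.
have [ws [k [ews _ st]]] := inner_step ix.
have [A2 s2 h2] := origin_step st oA'; have [j e] := onth_children ews xy.
by exists A2; [exact: leq_trans s2 sA'|exact: h2 e].
Qed.

(* Cutting the tree below [v] at the first nodes whose step has no counterpart
   in [Q] gives a [Q]-chain tree; such a step consumes one of the finitely many
   annotations in [A], whence the induction on [size A]. *)
Lemma mass_below_annot v A :
  annot_origin P A (ct_term v) -> ((prob v)%:E <= mass_below v)%E.
Proof.
have [n] := ubnP (size A); elim: n A v => // n IH A v; rewrite ltnS => sA ov.
(* A node is kept as long as every step strictly above it, from [v] on, is a step of [Q]. *)
pose D := [set w | descendant v w /\
  forall u, descendant v u -> descendant u w -> u <> w -> step_ok Q u].
have De u w : D u -> step_ok Q u -> edge u w -> D w.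
  move=> [vu hu] ok uw; split; first exact: descendant_edge uw.
  move=> x vx /(descendant_parent uw)[//|xu] _.
  by have [->//|xu'] := pselect (x = u); exact: hu.
have Dok u w : D u -> D w -> edge u w -> step_ok Q u.
  move=> [vu _] [vw hw] uw; apply: hw => //; first exact: edge_descendant.
  move=> euw; apply: (edge_acyclic uw); rewrite -euw; exact: descendant_refl.
have Dv : D v.
  split; first exact: descendant_refl.
  by move=> u vu uv []; exact: descendant_antisym.
have := @region_mass D v Dv; move=> /(_ (fun w Dw => proj1 Dw)) reg.
apply: (le_trans (reg _ _)).
- move=> w [/descendant_tailP[|[u vu uw]] hw]; first by left.
  right; exists u => //; split=> // x vx xu xu'.
  apply: hw => //; first exact: descendant_edge uw.
  by move=> xw; apply: (edge_acyclic uw); rewrite -xw.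
- by move=> u w Du Dw uw; have ok := Dok _ _ Du Dw uw; split=> // w'; exact: De.
apply: mass_below_ge => //.
- by move=> u [[]].
(* Border nodes are pairwise incomparable: the step at a border node strictly above another node of
   [D] would be a step of [Q], so its children would lie in [D]. *)
- have half u1 u2 : D u1 -> D u2 -> ~ (exists2 w, D w & edge u1 w) ->
      descendant u1 u2 -> u1 = u2.
    move=> D1 D2 f1 d12; have [//|ne] := pselect (u1 = u2).
    have ok : step_ok Q u1 by case: D2 => _; apply => //; case: D1.
    have [//|[y u1y _]] := descendant_headP d12.
    by case: f1; exists y => //; exact: De u1y.
  move=> u1 u2 x [D1 f1] [D2 f2] h1 h2.
  have [/half->//|/half e] := descendant_comparable h1 h2.
  by rewrite e.
(* A border node that is a leaf of [T] contributes its own probability. At an inner one the step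
   fails in [Q], so the list of old annotations shrinks and the induction hypothesis applies to the
   children. *)
move=> u [Du fu]; have [iu|lu] := pselect (inner u); last first.
  apply: esum_ge; exists [set u]; last by rewrite fsbig_set1.
  by split=> // _ ->; split=> //; exact: descendant_refl.
have nok : ~ step_ok Q u.
  by case: (iu) => w uw ok; apply: fu; exists w => //; exact: De uw.
have [A1 s1 o1] := annot_origin_descendant ov (proj1 Du).
have [ws [k [ews kP st]]] := inner_step iu.
have [stQ|[A2 s2 h2]] := conversion st o1; first by case: nok; exists ws, k.
apply: mass_below_inner => // w uw; have [j e] := onth_children ews uw.
by apply: (IH A2); [apply: leq_trans s2 _; exact: leq_trans s1 sA|exact: h2 e].
Qed.

(** At the root all annotations are old, so the finite list of their positions starts the
    induction. *)
Lemma leaf_mass_eq1 : leaf_mass T = 1%E.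
Proof.
apply/eqP; rewrite eq_le leaf_mass_le1//=.
have [A HA] := annotated_pos_finite (ct_term (Defs.root (ct_tree T))).
have := @mass_below_annot (Defs.root (ct_tree T)) A; rewrite ct_prob_root.
move=> /(_ (fun tau h => or_introl (HA tau h))) /le_trans; apply.
by apply: esum_subset => w [].
Qed.

End Region.

(** * The instantiation processor *)

Theorem theorem37 (R : realType) (S : signature) (V : Type)
    (P' : set (adp R S V)) (a : adp R S V)
    (P := P' `|` [set a])
    (Pa : ~ P' a) (PP : adp_problem P)
    (rho : V -> V) (Hrho : fresh_renaming P rho)
    (nu : position -> V) (Hnu : fresh_cap_vars P rho nu)
    (mgu : term S V -> term S V -> option (substitution S V))
    (Hmgu : mgu_choice mgu) :
  iAST P <-> iAST (P' `|` instances P rho nu mgu a `|` [set flat_adp a]).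
Proof.
have [_ wfP] := PP.
have Pa' : P a by right.
set Q := _ `|` [set flat_adp a].
have QP c : Q c -> exists2 b, P b & adp_simulates b c.
  move=> [[P'c|ic]|->].
  - by exists c; [left|exact: adp_simulates_refl].
  - have [delta fd ->] := instances_flat wfP Pa' Hmgu ic; exists a => //.
    exact: adp_simulates_subst.
  - by exists a => //; exact: adp_simulates_flat.
have PQ b : P b -> exists2 c, Q c &
  [/\ lhs c = lhs b, flag c = flag b &
      [seq (pr.1, flat pr.2) | pr <- rhs c] =
      [seq (pr.1, flat pr.2) | pr <- rhs b]].
  move=> [P'b|->]; first by exists b => //; left; left.
  exists (flat_adp a); first by right.
  split=> //; rewrite -map_comp; apply: eq_map => pr /=.
  by rewrite flat_idem.
have ANF_PQ : ANF P `<=` ANF Q.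
  apply: ANF_lhs => c /QP[b Pb [kappa [h [el _ _ _ _]]]].
  by exists b, kappa.
have ANF_QP : ANF Q `<=` ANF P.
  apply: ANF_lhs => b /PQ[c Qc [el _ _]].
  by exists c, (@Var S V); rewrite subst_Var.
split=> [iP T|iQ T].
  have [T' <-] := chain_tree_simulation
    (fun s s' k mu => @step_simulation R S V P Q s s' k mu QP ANF_QP) T.
  exact: iP.
have arises_PQ b sigma : P b -> ANF P (subst sigma (lhs b)) ->
    arises P (subst sigma (lhs b)) ->
  exists2 c, Q c & exists kappa,
    [/\ subst kappa (lhs c) = subst sigma (lhs b), flag c = flag b &
        [seq (pr.1, subst kappa pr.2) | pr <- rhs c] =
        [seq (pr.1, subst sigma pr.2) | pr <- rhs b]].
  move=> [P'b _ _|->]; first by exists b; [left; left|exists sigma].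
  move=> an ar.
  have [delta [kappa [ic k]]] := arises_instance wfP Pa' Hrho Hnu Hmgu an ar.
  (* The factorization [k] is known on the variables of [lhs a] only; the right-hand sides contain
     no others. *)
  have sk t : vars t `<=` vars (lhs a) ->
      subst kappa (subst delta t) = subst sigma t.
    by move=> ta; rewrite subst_comp; apply: eq_in_subst => x /ta/k.
  exists (subst_adp delta a); first by left; right.
  exists kappa; split=> //; first exact: sk.
  rewrite -map_comp; apply: eq_map_onth => j p r ar' /=; rewrite sk//.
  by have [_ _ _ /(_ _ _ _ ar')] := wfP _ Pa'.
apply: (leaf_mass_eq1 wfP iQ) => s k mu A; first exact: step_annot_origin.
exact: step_conversion.
Qed.
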